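(* Let $1\le N'\le N-1$, $H_1\in\mathcal H_\star(N'-1)$, and $H_2\in\mathcal H_\star(N-N'-1)$. Then $H_1\bowtie H_2\in\mathcal H_\star(N-1)$ and $\lambda^\star(H_1\bowtie H_2)=\lambda^\star(H_1)\bowtie\lambda^\star(H_2)$. Moreover, if $H_1,H_2$ are respectively vertices of $\mathcal H_\star(N'-1)$ and $\mathcal H_\star(N-N'-1)$, then $H_1\bowtie H_2$ is a vertex of $\mathcal H_\star(N-1)$ and $\mathcal G(H_1\bowtie H_2)=\mathcal G(H_1)\bowtie\mathcal G(H_2)$.
   Context: Algorithms. Let $N\ge 1$ be an integer. An H-matrix of size $N-1$ is a real lower triangular matrix $H=(h_{k,j})_{1\le j\le k\le N-1}$ (for $N=1$ it is the empty $0\times 0$ matrix $[\,]$, which belongs to $\mathcal H_\star(0)$). Given a real Hilbert space $\mathcal X$, an operator $T:\mathcal X\to\mathcal X$ and $y_0\in\mathcal X$, the algorithm defined by $H$ generates $y_{k+1}=y_k-\sum_{j=0}^{k}h_{k+1,j+1}(y_j-Ty_j)$ for $k=0,\dots,N-2$. $T$ is nonexpansive if $\|Tx-Ty\|\le\|x-y\|$ for all $x,y\in\mathcal X$; $y_\star$ is a fixed point if $Ty_\star=y_\star$. $\mathcal H_\star(N-1)$ is the set of H-matrices of size $N-1$ such that $\|y_{N-1}-Ty_{N-1}\|^2\le 4\|y_0-y_\star\|^2/N^2$ for every real Hilbert space $\mathcal X$, every nonexpansive $T:\mathcal X\to\mathcal X$ with a fixed point $y_\star$ and every $y_0\in\mathcal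 X$. H-certificates. For $m,j\in\{1,\dots,N-1\}$ let $Q(m,j;H)=\sum\prod_{r=1}^m h_{i(r),j(r)}$, the sum over all integers $j=j(1)\le i(1)<j(2)\le i(2)<\cdots<j(m)\le i(m)\le N-1$ (an empty sum is $0$). The H-certificates $\lambda^\star(H)$ are $\lambda^\star_{N,j}(H)=N\sum_{m=1}^{N-1}(-1)^{m-1}Q(m,j;H)$ for $1\le j\le N-1$, and $\lambda^\star_{k,j}(H)=N\sum_{\ell=1}^{N-1}\sum_{m=1}^{N-1}(-1)^{\ell+m-1}\binom{\ell+m}{m}Q(\ell,j;H)Q(m,k;H)$ for $1\le j<k\le N-1$ (for other sizes, replace $N-1$ by the size and $N$ by size plus one; $\lambda^\star([\,])=\emptyset$). Known fact (Yoon–Ryu–Grimmer): $H\in\mathcal H_\star(N-1)$ if and only if $\sum_{j=1}^{N-1}Q(k,j;H)=\frac1N\binom{N}{k+1}$ for $k=1,\dots,N-1$ and $\lambda^\star_{k,j}(H)\ge 0$ for all $1\le j<k\le N$. Vertices and arc diagrams. A vertex of $\mathcal H_\star(N-1)$ (optimal vertex algorithm) is an $H\in\mathcal H_\star(N-1)$ such that for each $j=1,\dots,N-1$ there is exactly one index $k(j)\in\{j+1,\dots,N\}$ with $\lambda^\star_{k(j),j}(H)>0$. An arc diagram on $N$ nodes is a graph on $\{1,\dots,N\}$ with edge (arc) set $\{(k(j),j):1\le j\le N-1\}$ for some integers $j<k(j)\le N$. The arc diagram $\mathcal G(H)$ of a vertex $H$ is the one given by its indices $k(j)$. Gluing of arc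 diagrams. For arc diagrams $\mathcal G_1$ on $N'$ nodes and $\mathcal G_2$ on $N-N'$ nodes, $\mathcal G_1\bowtie\mathcal G_2$ is the arc diagram on $N$ nodes obtained by relabeling the nodes of $\mathcal G_2$ as $N'+1,\dots,N$, placing it to the right of $\mathcal G_1$, and adding the arc $(N,N')$ joining the rightmost nodes. Gluing of H-matrices. $H_1\bowtie H_2$ is the lower triangular $(N-1)\times(N-1)$ matrix with entries: $h_{k,j}=(H_1)_{k,j}$ for $1\le j\le k\le N'-1$; $h_{k,j}=(H_2)_{k-N',j-N'}$ for $N'+1\le j\le k\le N-1$; $h_{k,j}=0$ for $j\le N'-1$, $k\ge N'+1$; $h_{N',j}=-\frac{N-N'}{N}\sum_{k=j}^{N'-1}(H_1)_{k,j}$ for $j\le N'-1$; $h_{N',N'}=\frac{N'(N-N')}{N}$; and $h_{N'+1,N'},\dots,h_{N-1,N'}$ are the unique values satisfying $Q(m,N';H_1\bowtie H_2)=\frac{N'(N-N'+1)}{N(m+1)}\binom{N-N'-1}{m-1}$ for $m=1,\dots,N-N'$. Gluing of H-certificates. $\lambda^\star(H_1)\bowtie\lambda^\star(H_2)$ is the collection $(\lambda^\star_{k,j})_{1\le j<k\le N}$ with: $\lambda^\star_{k,j}=\frac{N'}{N}\lambda^\star_{k,j}(H_1)$ for $1\le j<k\le N'$; $\lambda^\star_{k,j}=\frac{N}{N-N'}\lambda^\star_{k-N',j-N'}(H_2)$ for $N'+1\le j<k\le N$; $\lambda^\star_{N,N'}=\frac{N'}{N-N'}$; $\lambda^\star_{k,j}=0$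 for $1\le j<N'<k\le N$; and $\lambda^\star_{k,N'}=0$ for $k=N'+1,\dots,N-1$. *)

(* Defs.v *)
From HB Require Import structures.
From mathcomp Require Import all_boot all_order all_algebra.
From mathcomp Require Import all_classical all_reals all_analysis.

Set Implicit Arguments.
Unset Strict Implicit.
Unset Printing Implicit Defensive.

Import Order.TTheory GRing.Theory Num.Theory.
Import numFieldNormedType.Exports.

Local Open Scope classical_set_scope.
Local Open Scope ring_scope.

(* A real Hilbert space: a complete normed space whose norm is induced by an
   inner product. *)
Record hilbertSpace (R : realType) := HilbertSpace {
  hilbert_sort :> completeNormedModType R;
  hilbert_dot : {dot hilbert_sort for (idfun : R -> R)};
  hilbert_normE : forall x : hilbert_sort, `|x| ^+ 2 = hilbert_dot x x }.

Definition nonexpansive (R : realType) (X : hilbertSpace R) (T : X -> X) :=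
  forall x y : X, `|T x - T y| <= `|x - y|.

(* An H-matrix of size n = N - 1 is a matrix H : 'M[R]_n with is_trig_mx H
   (lower triangular).  Row k and column j are 0-based here, so that
   h_{k+1,j+1} is H k j.  The terms of y beyond index n are irrelevant. *)
Definition generates (R : realType) (n : nat) (H : 'M[R]_n)
    (X : hilbertSpace R) (T : X -> X) (y : nat -> X) :=
  forall k : 'I_n,
    y k.+1 = y k - \sum_(j < n | (j <= k)%N) H k j *: (y j - T (y j)).

(* The set H_star(n), with N = n.+1. *)
Definition Hstar (R : realType) (n : nat) : set 'M[R]_n :=
  [set H | is_trig_mx H /\
    forall (X : hilbertSpace R) (T : X -> X) (ystar : X) (y : nat -> X),
      nonexpansive T -> T ystar = ystar -> generates H T y ->
      `|y n - T (y n)| ^+ 2 <= 4 * `|y 0%N - ystar| ^+ 2 / n.+1%:R ^+ 2].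

(* Entry h_{k,j} with 1-based indices; meaningful for 1 <= j, k <= n only. *)
Definition entry (R : realType) (n : nat) (H : 'M[R]_n) (k j : nat) : R :=
  match insub k.-1, insub j.-1 with
  | Some a, Some b => H a b
  | _, _ => 0
  end.

(* Index sequences j = j(1) <= i(1) < j(2) <= i(2) < ... < j(m) <= i(m) <= n,
   where p.1 is i and p.2 is j, both shifted to be 0-based in r and in their
   values; the prescribed first value j is 1-based. *)
Definition interlaced (n m j : nat)
    (p : {ffun 'I_m -> 'I_n} * {ffun 'I_m -> 'I_n}) : bool :=
  [&& [forall r : 'I_m, (r == 0%N :> nat) ==> ((p.2 r).+1 == j)],
      [forall r : 'I_m, (p.2 r <= p.1 r)%N]
    & [forall r : 'I_m, forall s : 'I_m,
         (s == r.+1 :> nat) ==> (p.1 r < p.2 s)%N]].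

(* Meaningful for m >= 1 and 1-based j. *)
Definition Q (R : realType) (n : nat) (m j : nat) (H : 'M[R]_n) : R :=
  \sum_(p : {ffun 'I_m -> 'I_n} * {ffun 'I_m -> 'I_n} | interlaced j p)
    \prod_(r < m) H (p.1 r) (p.2 r).

(* Meaningful for 1 <= j < k <= N, where N = n.+1. *)
Definition lambda_star (R : realType) (n : nat) (H : 'M[R]_n)
    (k j : nat) : R :=
  if k == n.+1 then
    n.+1%:R * \sum_(1 <= m < n.+1) (-1) ^+ (m - 1) * Q m j H
  else
    n.+1%:R * \sum_(1 <= l < n.+1) \sum_(1 <= m < n.+1)
      (-1) ^+ (l + m - 1) * 'C(l + m, m)%:R * Q l j H * Q m k H.

Definition is_vertex (R : realType) (n : nat) (H : 'M[R]_n) :=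
  Hstar H /\
  forall j : nat, (1 <= j <= n)%N ->
    exists! k : nat, (j < k <= n.+1)%N /\ 0 < lambda_star H k j.

(* An arc diagram is represented by its set of arcs (k, j), j < k, on the nodes
   1, ..., N: the one given by the indices k(1), ..., k(N-1) is as follows. *)
Definition arcs_of (N : nat) (k : nat -> nat) : set (nat * nat) :=
  [set (k j, j) | j in [set j | (1 <= j <= N.-1)%N]].

(* The unique index k(j) of a vertex (an arbitrary admissible one, or 0, when H
   is not a vertex). *)
Definition vertex_index (R : realType) (n : nat) (H : 'M[R]_n)
    (j : nat) : nat :=
  xget 0%N [set k : nat | (j < k <= n.+1)%N /\ 0 < lambda_star H k j].

Definition arc_diagram (R : realType) (n : nat) (H : 'M[R]_n) :
    set (nat * nat) :=
  arcs_of n.+1 (vertex_index H).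

Definition glue_arcs (N N' : nat) (G1 G2 : set (nat * nat)) :
    set (nat * nat) :=
  G1 `|` [set ((a.1 + N')%N, (a.2 + N')%N) | a in G2] `|` [set (N, N')].

Definition is_glued (R : realType) (N N' : nat)
    (H1 : 'M[R]_(N'.-1)) (H2 : 'M[R]_((N - N').-1)) (H : 'M[R]_(N.-1)) :=
  [/\ is_trig_mx H,
      [/\ forall k j, (1 <= j <= k)%N -> (k <= N'.-1)%N ->
            entry H k j = entry H1 k j,
          forall k j, (N'.+1 <= j <= k)%N -> (k <= N.-1)%N ->
            entry H k j = entry H2 (k - N') (j - N')
        & forall k j, (1 <= j <= N'.-1)%N -> (N'.+1 <= k <= N.-1)%N ->
            entry H k j = 0],
      forall j, (1 <= j <= N'.-1)%N ->
        entry H N' j =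
          - ((N - N')%:R / N%:R) * \sum_(j <= k < N') entry H1 k j,
      entry H N' N' = N'%:R * (N - N')%:R / N%:R
    & forall m, (1 <= m <= N - N')%N ->
        Q m N' H =
          N'%:R * (N - N' + 1)%:R / (N%:R * (m + 1)%:R)
            * 'C((N - N' - 1)%N, (m - 1)%N)%:R].

(* The gluing of H1 and H2: the unique H with the prescribed entries and values
   Q(m, N'; H).  It is 0 if there is no such H or more than one; 0 is not in
   Hstar when the size is positive, so this default never makes a membership
   claim true. *)
Definition glue_mx (R : realType) (N N' : nat)
    (H1 : 'M[R]_(N'.-1)) (H2 : 'M[R]_((N - N').-1)) : 'M[R]_(N.-1) :=
  xget 0 [set H | unique (is_glued H1 H2) H].

(* Gluing of certificates, as functions of 1 <= j < k <= N. *)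
Definition glue_cert (R : realType) (N N' : nat)
    (l1 l2 : nat -> nat -> R) (k j : nat) : R :=
  if (k <= N')%N then N'%:R / N%:R * l1 k j
  else if (N' < j)%N then N%:R / (N - N')%:R * l2 (k - N')%N (j - N')%N
  else if (k == N) && (j == N') then N'%:R / (N - N')%:R
  else 0.

(* Main.v *)
(** If [T] acts as a linear isometry [z], adding [e] to the residual
    [y_j - T y_j] of step [j] adds [p_j(z) e] to the last residual, for a
    polynomial [p_j] whose coefficients in powers of [1 - z] are the
    [+-Q(m, j; H)].  In terms of the coefficients in powers of [z],
    [lambda_{k,j} = - N <p_j, p_k>], and [H] is optimal if and only if
    [sum_j p_j = (1 + z + .. + z^(N-1)) / N] and [<p_j, p_k> <= 0] for [j <> k].

    Sufficiency: with [X = sum_j p_j y_j] and [G = sum_j p_j g_j], where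
    [g_j = y_j - T y_j], the recursion for [y] says [(1 - z) X = G] up to boundary
    terms, so the sum over [b] of [<G_b - 2 X_b, G_b>] telescopes; as a
    combination of the nonexpansiveness inequalities it gives the rate.

    Necessity: the negacyclic shift of [R^N] started at [(1, .., 1)] has last
    residual twice the coefficient vector of [sum_j p_j], whose entries sum to
    [1]; the rate forces them to be equal.  Precomposing the shift with a
    nonexpansive perturbation of the identity for which, to first order, only the
    inequality between the iterates [j] and [k] becomes strict, the rate gives
    the sign of [<p_j, p_k>].

    Gluing: with [M = N - N'], the polynomials of the glued matrix are
    [(N'/N) z^M p1_j] for [j < N'], [(N'/N) (z^M - (1 + .. + z^(M-1)) / M)] for
    [j = N'], and [p2_(j-N')] for [j > N'], and all claims can be read off. *)

Require Import Defs.
From HB Require Import structures.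
From mathcomp Require Import all_boot all_order all_algebra.
From mathcomp Require Import all_classical all_reals all_analysis.
From mathcomp Require Import ring lra zify.

Set Implicit Arguments.
Unset Strict Implicit.
Unset Printing Implicit Defensive.

Import Order.TTheory GRing.Theory Num.Theory.
Import numFieldNormedType.Exports.

Local Open Scope classical_set_scope.
Local Open Scope ring_scope.

(** * Euclidean space as a Hilbert space *)

Definition euclid (R : realType) (n : nat) : Type := 'rV[R]_n.
HB.instance Definition _ (R : realType) (n : nat) :=
  GRing.Lmodule.copy (euclid R n) 'rV[R]_n.

Section Euclid.
Variables (R : realType) (n : nat).
Implicit Types u v w : euclid R n.

Definition edot u v : R := \sum_i (u 0 i) * (v 0 i).

Lemma edotC u v : edot u v = edot v u.
Proof. by apply: eq_bigr => i _; rewrite mulrC. Qed.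

Lemma edotDl u v w : edot (u + v) w = edot u w + edot v w.
Proof. by rewrite -big_split; apply: eq_bigr => i _; rewrite !mxE mulrDl. Qed.

Lemma edotZl c u w : edot (c *: u) w = c * edot u w.
Proof. by rewrite /edot mulr_sumr; apply: eq_bigr => i _; rewrite mxE mulrA. Qed.

Lemma edotNl u w : edot (- u) w = - edot u w.
Proof. by rewrite -scaleN1r edotZl mulN1r. Qed.

Lemma edotBl u v w : edot (u - v) w = edot u w - edot v w.
Proof. by rewrite edotDl edotNl. Qed.

Fact edot_zmod_l v : zmod_morphism (edot^~ v).
Proof. by move=> u w; rewrite edotBl. Qed.

Fact edot_zmod_r u : zmod_morphism (edot u).
Proof. by move=> v w; rewrite edotC edotBl !(edotC u). Qed.

Fact edot_scal_l v : scalable_for *%R (edot^~ v).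
Proof. by move=> c w; rewrite edotZl. Qed.

Fact edot_scal_r u : scalable_for (idfun \; *%R) (edot u).
Proof. by move=> c w; rewrite edotC edotZl edotC. Qed.

HB.instance Definition _ :=
  isBilinear.Build R (euclid R n) (euclid R n) R *%R (idfun \; *%R) edot
    edot_zmod_l edot_zmod_r edot_scal_l edot_scal_r.

Fact edot_herm u v : edot u v = (-1) ^+ false * idfun (edot v u).
Proof. by rewrite expr0 mul1r edotC. Qed.

HB.instance Definition _ :=
  isHermitianSesquilinear.Build R (euclid R n) false idfun edot edot_herm.

Lemma edot_ge0 u : 0 <= edot u u.
Proof. by apply: sumr_ge0 => i _; rewrite -expr2 sqr_ge0. Qed.

Lemma edot_eq0 u : edot u u = 0 -> u = 0.
Proof.
move=> /eqP; rewrite psumr_eq0 => [/allP h|i _]; last by rewrite -expr2 sqr_ge0.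
apply/rowP => i; rewrite mxE; apply/eqP.
by have := h i; rewrite mem_index_enum mulf_eq0 orbb; apply.
Qed.

Fact edot_gt0 u : u != 0 -> 0 < edot u u.
Proof.
move=> u0; rewrite lt_def edot_ge0 andbT; apply: contra u0 => /eqP.
by move/edot_eq0 => ->.
Qed.

HB.instance Definition _ := isDotProduct.Build R (euclid R n) edot edot_gt0.

Lemma edotZr c u v : edot u (c *: v) = c * edot u v.
Proof. by rewrite edotC edotZl edotC. Qed.

Lemma edotDr u v w : edot u (v + w) = edot u v + edot u w.
Proof. by rewrite edotC edotDl !(edotC u). Qed.

Lemma edotBr u v w : edot u (v - w) = edot u v - edot u w.
Proof. by rewrite edotC edotBl !(edotC u). Qed.

Lemma edot_sumr I (r : seq I) (P : pred I) (F : I -> euclid R n) u :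
  edot u (\sum_(i <- r | P i) F i) = \sum_(i <- r | P i) edot u (F i).
Proof. exact: linear_sumr. Qed.

Lemma edot_suml I (r : seq I) (P : pred I) (F : I -> euclid R n) u :
  edot (\sum_(i <- r | P i) F i) u = \sum_(i <- r | P i) edot (F i) u.
Proof. by rewrite edotC edot_sumr; apply: eq_bigr => i _; rewrite edotC. Qed.

Lemma edot_CauchySchwarz u v : edot u v ^+ 2 <= edot u u * edot v v.
Proof.
have [->|/edot_gt0 v0] := eqVneq v 0.
  by rewrite -(scale0r (0 : euclid R n)) !edotZr !mul0r mulr0 expr0n.
(* This vector is a multiple of the component of [u] orthogonal to [v]; its square is
   [<v,v> (<u,u> <v,v> - <u,v>^2)]. *)
have := edot_ge0 (edot v v *: u - edot u v *: v).
rewrite !(edotBl, edotBr, edotZl, edotZr) (edotC v u) => h.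
rewrite -subr_ge0 -(pmulr_rge0 _ v0); apply: le_trans h _.
by rewrite le_eqVlt; apply/orP; left; apply/eqP; ring.
Qed.

Definition enorm u : R := Num.sqrt (edot u u).

Lemma enorm_sqr u : enorm u ^+ 2 = edot u u.
Proof. by rewrite sqr_sqrtr // edot_ge0. Qed.

Fact enormD u v : enorm (u + v) <= enorm u + enorm v.
Proof.
have h0 w : 0 <= enorm w by exact: sqrtr_ge0.
have uv : edot u v <= enorm u * enorm v.
  rewrite (le_trans (ler_norm _)) // -(@ler_pXn2r _ 2) ?nnegrE ?mulr_ge0 //.
  by rewrite real_normK ?num_real // exprMn !enorm_sqr edot_CauchySchwarz.
rewrite -(@ler_pXn2r _ 2) ?nnegrE ?addr_ge0 //.
rewrite sqrrD !enorm_sqr !(edotDl, edotDr) (edotC v u).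
by move: uv; lra.
Qed.

Fact enormZ c u : enorm (c *: u) = `|c| * enorm u.
Proof.
by rewrite /enorm edotZl edotZr mulrA -expr2 sqrtrM ?sqr_ge0 // sqrtr_sqr.
Qed.

Fact enorm0_eq0 u : enorm u = 0 -> u = 0.
Proof. by move=> h; apply: edot_eq0; rewrite -enorm_sqr h expr0n. Qed.

HB.instance Definition _ :=
  Lmodule_isNormed.Build R (euclid R n) enormD enormZ enorm0_eq0.

Lemma euclid_normE u : `|u| ^+ 2 = edot u u.
Proof. exact: enorm_sqr. Qed.

Lemma coord_le_enorm u i : `|u 0 i| <= `|u|.
Proof.
rewrite -(@ler_pXn2r _ 2) ?nnegrE //.
rewrite euclid_normE /edot (bigD1 i) //= real_normK ?num_real // expr2 lerDl.
by apply: sumr_ge0 => j _; rewrite -expr2 sqr_ge0.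
Qed.

Lemma enorm_le_coord u (e : R) : 0 <= e -> (forall i, `|u 0 i| <= e) ->
  `|u| <= Num.sqrt n%:R * e.
Proof.
move=> e0 h; rewrite -(@ler_pXn2r _ 2) ?nnegrE ?mulr_ge0 ?sqrtr_ge0 //.
rewrite euclid_normE exprMn sqr_sqrtr ?ler0n // mulr_natl.
rewrite -[X in _ *+ X]card_ord -sumr_const; apply: ler_sum => i _.
by rewrite -expr2 -real_normK ?num_real // ler_pXn2r ?nnegrE.
Qed.

Lemma euclid_complete (F : set_system (euclid R n)) :
  ProperFilter F -> cauchy F -> cvg F.
Proof.
move=> FF /cauchy_ballP Fc.
have cc (i : 'I_n) : cvg ((fun u : euclid R n => u 0 i) @ F).
  apply: R_complete; apply/cauchy_ballP => e e0.
  have := Fc e e0; rewrite /= => -[[A B] [/= FA FB] AB].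
  exists ((fun u : euclid R n => u 0 i) @` A, (fun u : euclid R n => u 0 i) @` B).
    split; [apply: filterS FA|apply: filterS FB] => u ?; by exists u.
  move=> [a b] [/= [u Au <-] [v Bv <-]].
  have := AB (u, v) (conj Au Bv); rewrite /= -!ball_normE /ball_ /=.
  apply: le_lt_trans; have := coord_le_enorm (u - v) i; by rewrite !mxE.
pose l : euclid R n := \row_i lim ((fun u : euclid R n => u 0 i) @ F).
apply/cvg_ex; exists l; apply/cvgrPdist_le => e e0.
(* Precision [d] in each coordinate gives precision [sqrt n * d <= e] in norm; the [+ 1] keeps the
   denominator positive when [n = 0]. *)
pose d := e / (Num.sqrt n%:R + 1).
have s0 : 0 <= Num.sqrt (n%:R : R) by exact: sqrtr_ge0.
have d0 : 0 < d by rewrite divr_gt0 // ltr_wpDl.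
have H : \forall u \near F, forall i : 'I_n, `|l 0 i - (u : euclid R n) 0 i| <= d.
  apply: filter_forall => i; rewrite mxE.
  by have /cvgrPdist_le /(_ d d0) := cc i.
apply: filterS H => u h.
have := @enorm_le_coord (l - u) d (ltW d0); move/(_ _)/le_trans; apply.
  by move=> i; have := h i; rewrite !mxE.
rewrite /d mulrA ler_pdivrMr ?ltr_wpDl // mulrC ler_wpM2l ?ltW //.
by rewrite ltrDl.
Qed.

HB.instance Definition _ := Uniform_isComplete.Build (euclid R n) euclid_complete.

Definition euclid_hilbert : hilbertSpace R :=
  HilbertSpace (hilbert_dot := edot) euclid_normE.

End Euclid.

(** * Impulse polynomials *)

Section Impulse.
Variables (R : realType) (n : nat).
Implicit Types (h : nat -> nat -> R) (p : nat -> {poly R}).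

(* [p j] belongs to the node [j + 1] of the paper.  Adding [e] to the [j]-th
   residual of a linear iteration [T = z] adds [p j] at [z] applied to [e] to the
   [n]-th residual, whence [p n = 1]. *)
Definition impulse h p :=
  p n = 1 /\
  forall j, (j < n)%N -> p j =
    ('X - 1) * \sum_(i < n | (j <= i)%N)
                 h i j *: \sum_(k < n.+1 | (i < k)%N) p k.

(** Descending induction on [j]: the recursion expresses [p j] through the [p k] with [k > j]
    only. *)
Lemma impulse_unique h p q : impulse h p -> impulse h q ->
  forall j, (j <= n)%N -> p j = q j.
Proof.
move=> [pn ph] [qn qh] j; move: {2}(n - j)%N (leqnn (n - j)) => m.
elim: m j => [|m IH] j hm jn.
  by rewrite (_ : j = n) ?pn ?qn //; lia.
have [jn'|jn'] := ltnP j n; last by rewrite (_ : j = n) ?pn ?qn //; lia.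
rewrite ph // qh //; congr (_ * _); apply: eq_bigr => i ji; congr (_ *: _).
by apply: eq_bigr => k ik; apply: IH; have := ltn_ord k; lia.
Qed.

Section Theory.
Variables (h : nat -> nat -> R) (p : nat -> {poly R}).
Hypothesis hp : impulse h p.

Lemma size_impulse j : (j <= n)%N -> (size (p j) <= (n - j).+1)%N.
Proof.
case: hp => pn ph; move: {2}(n - j)%N (leqnn (n - j)) => m.
elim: m j => [|m IH] j hm jn.
  by rewrite (_ : j = n) ?pn ?size_poly1 //; lia.
have [jn'|jn'] := ltnP j n; last first.
  by rewrite (_ : j = n) ?pn ?size_poly1 //; lia.
rewrite ph // (leq_trans (size_polyMleq _ _)) //.
have -> : size ('X - 1 : {poly R}) = 2 by rewrite -polyC1 size_XsubC.
rewrite /= ltnS (leq_trans (size_sum _ _ _)) //; apply/bigmax_leqP => i ji.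
rewrite (leq_trans (size_scale_leq _ _)) // (leq_trans (size_sum _ _ _)) //.
by apply/bigmax_leqP => k ik; have := ltn_ord k => kn;
  apply: (leq_trans (IH k _ _)); lia.
Qed.

Lemma impulse_root1 j : (j <= n)%N -> (p j).[1] = (j == n)%:R.
Proof.
case: hp => pn ph; case: eqP => [-> _|? jn]; first by rewrite pn hornerC.
by rewrite ph ?hornerM; [rewrite !hornerE subrr mul0r | lia].
Qed.

Definition psum : {poly R} := \sum_(k < n.+1) p k.

Lemma size_psum : (size psum <= n.+1)%N.
Proof.
rewrite (leq_trans (size_sum _ _ _)) //; apply/bigmax_leqP => k _.
by have := ltn_ord k => ?; apply: (leq_trans (size_impulse _)); lia.
Qed.

Section Trajectory.
Variables (V : lmodType R) (y g : nat -> V).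
Hypothesis hy : forall k, (k < n)%N ->
  y k.+1 = y k - \sum_(j < n | (j <= k)%N) h k j *: g j.

Definition coefcomb (z : nat -> V) b := \sum_(k < n.+1) (p k)`_b *: z k.

Lemma trajectoryE k : (k <= n)%N ->
  y k = y 0%N - \sum_(i < n | (i < k)%N) \sum_(j < n | (j <= i)%N) h i j *: g j.
Proof.
elim: k => [|k IH] kn; first by rewrite big1 ?subr0.
rewrite hy // IH 1?ltnW // -addrA -opprD; congr (_ - _).
rewrite [RHS](bigD1 (Ordinal kn)) //= [RHS]addrC; congr (_ + _).
by apply: eq_bigl => i; rewrite ltnS ltn_neqAle andbC.
Qed.

(** The cofactor of ['X - 1] in [p j]; up to sign it also collects the effect of [g j] on the
    combination of all the [y k]. *)
Let s j : {poly R} :=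
  \sum_(i < n | (j <= i)%N) h i j *: \sum_(k < n.+1 | (i < k)%N) p k.

Let coefcombE b : coefcomb y b = psum`_b *: y 0%N - \sum_(j < n) (s j)`_b *: g j.
Proof.
rewrite /coefcomb.
under eq_bigr => k _ do rewrite (trajectoryE (ltn_ord k)) scalerBr.
rewrite sumrB -scaler_suml coef_sum; congr (_ - _).
under eq_bigr => k _ do rewrite scaler_sumr.
rewrite (exchange_big_dep predT) //=.
under eq_bigr => i _.
  under eq_bigr => k _ do rewrite scaler_sumr.
  rewrite (exchange_big_dep (fun j : 'I_n => (j <= i)%N)) //=.
over.
rewrite (exchange_big_dep predT) //=.
apply: eq_bigr => j _; rewrite coef_sum scaler_suml; apply: eq_bigr => i ji.
rewrite coefZ coef_sum mulr_sumr scaler_suml.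
by apply: eq_big => [k|k _]; rewrite ?ji ?andbT // scalerA mulrC.
Qed.

Let coefcombgE b : coefcomb g b =
  \sum_(j < n) (('X - 1) * s j)`_b *: g j + (b == 0%N)%:R *: g n.
Proof.
rewrite /coefcomb big_ord_recr /= (proj1 hp) coef1; congr (_ + _).
by apply: eq_bigr => j _; rewrite (proj2 hp).
Qed.

(** Let [X] and [G] be the vector-valued polynomials with coefficients [coefcomb y] and
    [coefcomb g]. Eliminating [s] from the two preceding formulas gives
    [(1 - 'X) X = (1 - 'X) psum y_0 + G - g_n]. Here is its constant coefficient; [coefcombS] gives
    the others. *)
Lemma coefcomb0 :
  coefcomb y 0 = psum`_0 *: y 0%N + coefcomb g 0 - g n.
Proof.
rewrite coefcombE coefcombgE scale1r -addrA addrK; congr (_ + _).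
rewrite -sumrN; apply: eq_bigr => j _.
by rewrite mulrBl mul1r coefB coefXM sub0r scaleNr.
Qed.

Lemma coefcombS b : coefcomb y b.+1 - coefcomb y b =
  (psum`_b.+1 - psum`_b) *: y 0%N + coefcomb g b.+1.
Proof.
rewrite !coefcombE coefcombgE scale0r addr0 opprD opprK addrACA -scalerBl; congr (_ + _).
rewrite addrC -sumrB; apply: eq_bigr => j _.
by rewrite mulrBl mul1r coefB coefXM /= scalerBl.
Qed.

Lemma coefcomb_ge b (z : nat -> V) : (n < b)%N -> coefcomb z b = 0.
Proof.
move=> nb; apply: big1 => k _; rewrite nth_default ?scale0r //.
by apply: (leq_trans (size_impulse (ltn_ord k))); lia.
Qed.

End Trajectory.
End Theory.
End Impulse.

(** * From certificates to the rate *)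

Section Dot.
Variables (R : realType) (V : lmodType R) (f : {dot V for (idfun : R -> R)}).

Lemma hdotC u v : f u v = f v u.
Proof. by rewrite hermitian_subproof expr0 mul1r. Qed.
Lemma hdotBl u v w : f (u - v) w = f u w - f v w.
Proof. exact: linearBl. Qed.
Lemma hdotBr u v w : f w (u - v) = f w u - f w v.
Proof. exact: linearBr. Qed.
Lemma hdotDl u v w : f (u + v) w = f u w + f v w.
Proof. exact: linearDl. Qed.
Lemma hdotDr u v w : f w (u + v) = f w u + f w v.
Proof. exact: linearDr. Qed.
Lemma hdotZl c u w : f (c *: u) w = c * f u w.
Proof. exact: linearZl_LR. Qed.
Lemma hdotZr c u w : f w (c *: u) = c * f w u.
Proof. exact: linearZr_LR. Qed.
Lemma hdot_suml I (r : seq I) (P : pred I) F w :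
  f (\sum_(i <- r | P i) F i) w = \sum_(i <- r | P i) f (F i) w.
Proof. exact: linear_sumlz. Qed.
Lemma hdot_sumr I (r : seq I) (P : pred I) F w :
  f w (\sum_(i <- r | P i) F i) = \sum_(i <- r | P i) f w (F i).
Proof. exact: linear_sumr. Qed.
Lemma hdot_ge0 u : 0 <= f u u.
Proof.
have [->|/neq0_dnorm_gt0/ltW //] := eqVneq u 0.
by rewrite -(scale0r (0 : V)) hdotZl mul0r.
Qed.
End Dot.

Definition pdot (R : realType) (n : nat) (p q : {poly R}) : R :=
  \sum_(b < n.+1) p`_b * q`_b.

Lemma pdotC (R : realType) (n : nat) (p q : {poly R}) : pdot n p q = pdot n q p.
Proof. by apply: eq_bigr => b _; rewrite mulrC. Qed.

Definition flat (R : realType) (n : nat) (p : nat -> {poly R}) :=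
  psum n p = \poly_(b < n.+1) n.+1%:R^-1.

Definition ent (R : realType) (n : nat) (H : 'M[R]_n) (i j : nat) : R :=
  entry H i.+1 j.+1.

Lemma ent_ord (R : realType) (n : nat) (H : 'M[R]_n) (i j : 'I_n) :
  ent H i j = H i j.
Proof. by rewrite /ent /entry /= !valK. Qed.

Section Sufficiency.
Variables (R : realType) (n : nat) (h : nat -> nat -> R) (p : nat -> {poly R}).
Hypotheses (hp : impulse n h p) (fp : flat n p).

Lemma pdot_sum (q : {poly R}) : (size q <= n.+1)%N ->
  \sum_(k < n.+1) pdot n (p k) q = q.[1] / n.+1%:R.
Proof.
move=> sq; rewrite exchange_big /= (horner_coef_wide _ sq) mulr_suml.
apply: eq_bigr => b _; rewrite expr1n mulr1 -mulr_suml -coef_sum.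
by rewrite -/(psum n p) fp coef_poly ltn_ord mulrC.
Qed.

Section Energy.
Variables (V : lmodType R) (f : {dot V for (idfun : R -> R)}) (y g : nat -> V).
Hypothesis hy : forall k, (k < n)%N ->
  y k.+1 = y k - \sum_(j < n | (j <= k)%N) h k j *: g j.

Lemma energy_identity :
  \sum_(j < n.+1) \sum_(k < n.+1)
     pdot n (p j) (p k) * f (g j - 2 *: y j) (g k) =
  f (g n) (g n) - 2 / n.+1%:R * f (g n) (y 0%N).
Proof.
pose X := coefcomb n p y; pose G := coefcomb n p g.
have -> : \sum_(j < n.+1) \sum_(k < n.+1)
     pdot n (p j) (p k) * f (g j - 2 *: y j) (g k) =
   \sum_(b < n.+1) f (G b - 2 *: X b) (G b).
  rewrite /pdot.
  under eq_bigr => j _.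
    under eq_bigr => k _ do rewrite mulr_suml.
    rewrite exchange_big /=.
  over.
  rewrite exchange_big /=; apply: eq_bigr => b _.
  rewrite /G /X /coefcomb scaler_sumr -sumrB hdot_suml; apply: eq_bigr => j _.
  rewrite hdot_sumr; apply: eq_bigr => k _.
  by rewrite hdotZr scalerA [2 * _]mulrC -scalerA -scalerBr hdotZl; ring.
have X0 : X 0%N = n.+1%:R^-1 *: y 0%N + G 0%N - g n.
  by rewrite /X (coefcomb0 hp hy) fp coef_poly.
(* By the degree bound [X] and [G] vanish beyond [n], so the recursion at [b = n] reads
   [- X n = - y 0 / N]. *)
have Xn : X n = n.+1%:R^-1 *: y 0%N.
  have := coefcombS hp hy n; rewrite !(coefcomb_ge hp _ (ltnSn n)) -/(X n) fp.
  rewrite !coef_poly ltnn ltnSn !sub0r addr0 scaleNr => /eqP.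
  by rewrite eqr_opp => /eqP.
have GS b : (b < n)%N -> G b.+1 = X b.+1 - X b.
  move=> bn; rewrite (coefcombS hp hy) fp !coef_poly ltnS bn ltnS (ltnW bn).
  by rewrite subrr scale0r add0r.
(* The cross terms of [f (G - 2 X) G] cancel as [G b.+1 = X b.+1 - X b]. *)
have tele m : (m <= n)%N -> \sum_(b < m) f (G b.+1 - 2 *: X b.+1) (G b.+1) =
     f (X 0%N) (X 0%N) - f (X m) (X m).
  elim: m => [|m IH] mn; first by rewrite big_ord0 subrr.
  rewrite big_ord_recr /= IH 1?ltnW // GS //.
  rewrite !(hdotBl, hdotBr, hdotZl) (hdotC f (X m) (X m.+1)); ring.
rewrite big_ord_recl /= tele // Xn.
have -> : G 0%N = X 0%N + g n - n.+1%:R^-1 *: y 0%N by rewrite X0 subrK addrC addKr.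
rewrite !(hdotBl, hdotBr, hdotZl, hdotZr, hdotDl, hdotDr).
by rewrite (hdotC f (y 0%N) (g n)) (hdotC f (g n) (X 0%N))
   (hdotC f (y 0%N) (X 0%N)); ring.
Qed.

End Energy.

Hypothesis np : forall j k, (j <= n)%N -> (k <= n)%N -> j != k ->
  pdot n (p j) (p k) <= 0.

Lemma rate (V : lmodType R) (f : {dot V for (idfun : R -> R)})
    (y g : nat -> V) (z : V) :
  (forall k, (k < n)%N ->
    y k.+1 = y k - \sum_(j < n | (j <= k)%N) h k j *: g j) ->
  (forall j k, f (g j - g k) (g j - g k) <= 2 * f (y j - y k) (g j - g k)) ->
  f (g n) (g n) <= 2 * f (y n - z) (g n) ->
  f (g n) (g n) <= 4 * f (y 0%N - z) (y 0%N - z) / n.+1%:R ^+ 2.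
Proof.
move=> hy hc hz.
pose D (j k : nat) := f (g j - 2 *: y j) (g k).
(* [C j k <= 0] is nonexpansiveness between the iterates [j] and [k].  The Gram
   matrix of [p] has zero row sums except in row [n], hence in the sum of the
   [C j k] weighted by it the only diagonal term to survive is [D n n]. *)
pose C (j k : nat) := D j j + D k k - D j k - D k j.
have C_le0 j k : C j k <= 0.
  apply: le_trans (_ : f (g j - g k) (g j - g k) - 2 * f (y j - y k) (g j - g k) <= 0).
    by rewrite /C /D !(hdotBl, hdotBr, hdotZl); lra.
  by rewrite subr_le0.
have C0 j : C j j = 0 by rewrite /C; ring.
have pos : 0 <= \sum_(j < n.+1) \sum_(k < n.+1) pdot n (p j) (p k) * C j k.
  apply: sumr_ge0 => j _; apply: sumr_ge0 => k _.
  have [->|jk] := eqVneq k j; first by rewrite C0 mulr0.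
  by rewrite mulr_le0 // np ?leq_ord // eq_sym.
have row (k : 'I_n.+1) :
    \sum_(j < n.+1) pdot n (p j) (p k) = (k == n :> nat)%:R / n.+1%:R.
  have sk := size_impulse hp (leq_ord k).
  by rewrite pdot_sum ?(impulse_root1 hp) ?leq_ord // (leq_trans sk) ?ltnS ?leq_subr.
have diag : \sum_(j < n.+1) \sum_(k < n.+1) pdot n (p j) (p k) * D k k =
    D n n / n.+1%:R.
  rewrite exchange_big /= big_ord_recr /= big1 => [|k _].
    by rewrite -mulr_suml (row ord_max) eqxx add0r mul1r mulrC.
  rewrite -mulr_suml (row (widen_ord (leqnSn n) k)) /=.
  by rewrite (ltn_eqF (ltn_ord k)) !mul0r.
have tr (F : nat -> nat -> R) :
    \sum_(j < n.+1) \sum_(k < n.+1) pdot n (p j) (p k) * F k j =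
    \sum_(j < n.+1) \sum_(k < n.+1) pdot n (p j) (p k) * F j k.
  rewrite exchange_big; apply: eq_bigr => j _; apply: eq_bigr => k _.
  by rewrite pdotC.
have E : \sum_(j < n.+1) \sum_(k < n.+1) pdot n (p j) (p k) * C j k =
   2 * (D n n / n.+1%:R - (f (g n) (g n) - 2 / n.+1%:R * f (g n) (y 0%N))).
  rewrite -(energy_identity f hy) -diag.
  transitivity (\sum_(j < n.+1) \sum_(k < n.+1)
     (pdot n (p j) (p k) * D j j + pdot n (p j) (p k) * D k k
     - pdot n (p j) (p k) * D j k - pdot n (p j) (p k) * D k j)).
    by apply: eq_bigr => j _; apply: eq_bigr => k _; rewrite /C; ring.
  under eq_bigr => j _ do rewrite !sumrB big_split /=.
  rewrite !sumrB big_split /= (tr D) (tr (fun j k => D k k)) /D; ring.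
move: pos; rewrite {}E pmulr_rge0 // subr_ge0.
set N := n.+1%:R; have N0 : 0 < N by rewrite ltr0n.
rewrite /D hdotBl hdotZl => pos.
(* Adding the inequality [hz] against the fixed point [z] eliminates [y n]. *)
have {}pos : N * f (g n) (g n) <= 2 * f (g n) (y 0%N - z).
  move: hz pos; have -> : 2 / N * f (g n) (y 0%N) = 2 * f (g n) (y 0%N) / N by ring.
  rewrite lerBlDr -mulrDl ler_pdivlMr // hdotBl hdotBr (hdotC f z).
  by rewrite (hdotC f (g n) (y 0%N)) [_ * N]mulrC; lra.
move: (y 0%N - z) pos => w pos.
(* Expanding [|2 w - N g_n|^2 >= 0] and inserting [N |g_n|^2 <= 2 <g_n, w>] gives
   [N^2 |g_n|^2 <= 4 |w|^2]. *)
have := hdot_ge0 f (2 *: w - N *: g n).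
rewrite !(hdotBl, hdotBr, hdotZl, hdotZr) (hdotC f w) => h0.
rewrite ler_pdivlMr ?exprn_gt0 // expr2.
have := ler_wpM2l (ltW N0) pos; move: h0; nra.
Qed.
End Sufficiency.

(** Writing [T u - T v] as [(u - v) - (g_u - g_v)] with the residuals [g], nonexpansiveness becomes
    [|g_u - g_v|^2 <= 2 <u - v, g_u - g_v>], the form that [rate] consumes; at the fixed point the
    residual is zero. *)
Lemma Hstar_of_impulse (R : realType) (n : nat) (H : 'M[R]_n)
    (p : nat -> {poly R}) :
  is_trig_mx H -> impulse n (ent H) p -> flat n p ->
  (forall j k, (j <= n)%N -> (k <= n)%N -> j != k -> pdot n (p j) (p k) <= 0) ->
  Hstar H.
Proof.
move=> Ht hp fp np; split=> // X T z y Tne Tz gen.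
pose f := hilbert_dot X.
have nE (u : X) : `|u| ^+ 2 = f u u by exact: hilbert_normE.
have ne u v : f (T u - T v) (T u - T v) <= f (u - v) (u - v).
  by rewrite -!nE ler_pXn2r ?nnegrE.
rewrite !nE; apply: (rate hp fp np (f := f) (g := fun j => y j - T (y j))).
- move=> k kn; rewrite (gen (Ordinal kn)) /=; congr (_ - _).
  by apply: eq_bigr => j _; rewrite -(ent_ord H (Ordinal kn)).
- move=> j k; have := ne (y j) (y k).
  have -> : T (y j) - T (y k) = (y j - y k) - (y j - T (y j) - (y k - T (y k))).
    suff -> : y j - T (y j) - (y k - T (y k)) = y j - y k - (T (y j) - T (y k)).
      by rewrite subKr.
    by rewrite !opprB addrACA [RHS]addrACA; congr (_ + _); rewrite addrC.
  move: (y j - y k) (y j - T (y j) - (y k - T (y k))) => u v.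
  by rewrite (hdotBl f u v) !(hdotBr f) (hdotC f v u); lra.
have := ne (y n) z; rewrite Tz.
have -> : T (y n) - z = (y n - z) - (y n - T (y n)).
  by rewrite opprB [RHS]addrC addrA subrK.
move: (y n - z) (y n - T (y n)) => u v.
by rewrite (hdotBl f u v) !(hdotBr f) (hdotC f v u); lra.
Qed.

(** * The certificates as Gram matrices *)

Section InterlacedSums.
Variables (R : realType) (n : nat) (H : 'M[R]_n).

Let pairs m := ({ffun 'I_m -> 'I_n} * {ffun 'I_m -> 'I_n})%type.

Let weight m (p : pairs m) := \prod_(r < m) H (p.1 r) (p.2 r).

Let chain m (p : pairs m) :=
  [forall r : 'I_m, (p.2 r <= p.1 r)%N] &&
  [forall r : 'I_m, forall s : 'I_m, (s == r.+1 :> nat) ==> (p.1 r < p.2 s)%N].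

(** For [m = 0] this is vacuous, so the empty chain may follow any head pair. *)
Let above m (i : nat) (p : pairs m) :=
  [forall r : 'I_m, (r == 0%N :> nat) ==> (i < p.2 r)%N].

Let extend m (x : ('I_n * 'I_n) * pairs m) : pairs m.+1 :=
  ([ffun r => oapp x.2.1 x.1.1 (unlift ord0 r)],
   [ffun r => oapp x.2.2 x.1.2 (unlift ord0 r)]).

Let shrink m (p : pairs m.+1) : ('I_n * 'I_n) * pairs m :=
  ((p.1 ord0, p.2 ord0),
   ([ffun r => p.1 (lift ord0 r)], [ffun r => p.2 (lift ord0 r)])).

Let extendK m : cancel (@extend m) (@shrink m).
Proof.
move=> [[i j] [f g]]; rewrite /shrink /extend /= !ffunE unlift_none /=.
by congr (_, (_, _)); apply/ffunP => r; rewrite !ffunE liftK.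
Qed.

Let shrinkK m : cancel (@shrink m) (@extend m).
Proof.
move=> [f g]; rewrite /shrink /extend /=.
by congr (_, _); apply/ffunP => r; rewrite !ffunE; case: unliftP => [s|] ->;
  rewrite /= ?ffunE.
Qed.

Let chain_extend m i j (p : pairs m) :
  chain (extend ((i, j), p)) = [&& (j <= i)%N, above i p & chain p].
Proof.
apply/andP/and3P => [[/forallP h1 /forallP h2]|[ji /forallP ab /andP[/forallP h1 /forallP h2]]].
  split.
  - by have := h1 ord0; rewrite !ffunE unlift_none.
  - apply/forallP => r; apply/implyP => /eqP r0.
    have /forallP/(_ (lift ord0 r)) := h2 ord0.
    by rewrite !ffunE unlift_none liftK /= r0.
  apply/andP; split; apply/forallP => r.
    by have := h1 (lift ord0 r); rewrite !ffunE liftK.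
  apply/forallP => s; have /forallP/(_ (lift ord0 s)) := h2 (lift ord0 r).
  by rewrite !ffunE !liftK.
split; apply/forallP => r.
  by rewrite !ffunE; case: unliftP => [s|] _ /=.
apply/forallP => s; rewrite !ffunE.
case: (unliftP ord0 s) => [s'|] -> //=.
case: (unliftP ord0 r) => [r'|] -> /=; last exact: ab.
by have /forallP := h2 r'; apply.
Qed.

Lemma Q_head m (j : 'I_n) : Q m.+1 j.+1 H =
  \sum_(i < n | (j <= i)%N) H i j *
    \sum_(p : pairs m | above i p && chain p) weight p.
Proof.
rewrite /Q (reindex (@extend m)) /=; last first.
  by apply: onW_bij; exists (@shrink m); [exact: extendK | exact: shrinkK].
transitivity (\sum_(x : ('I_n * 'I_n) * pairs m |
   [&& x.1.2 == j, (x.1.2 <= x.1.1)%N, above x.1.1 x.2 & chain x.2])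
   H x.1.1 x.1.2 * weight x.2).
  apply: eq_big => [[[i k] p]|[[i k] p] _]; last first.
    rewrite big_ord_recl !ffunE unlift_none /=; congr (_ * _).
    by apply: eq_bigr => r _; rewrite !ffunE liftK.
  rewrite /= -chain_extend /interlaced -/(chain _); congr (_ && _).
  apply/forallP/eqP => [/(_ ord0)|->].
    by rewrite !ffunE unlift_none /= eqSS => /eqP/val_inj.
  move=> r; apply/implyP => /eqP r0.
  by rewrite (_ : r = ord0) ?ffunE ?unlift_none //; exact/val_inj.
under [RHS]eq_bigr => i _ do rewrite mulr_sumr.
rewrite pair_big_dep /=.
rewrite (reindex_onto (fun y : 'I_n * pairs m => ((y.1, j), y.2))
   (fun x => (x.1.1, x.2))) /=; last first.
  by move=> [[i k] p] /= /andP[/eqP -> _].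
by apply: eq_bigl => -[i p]; rewrite !eqxx /= andbT.
Qed.

Lemma Q_tail m (i : 'I_n) :
  \sum_(p : pairs m.+1 | above i p && chain p) weight p =
  \sum_(k < n | (i < k)%N) Q m.+1 k.+1 H.
Proof.
rewrite (partition_big (fun p : pairs m.+1 => p.2 ord0) (fun k => i < k)%N) /=.
  apply: eq_bigr => k ik; apply: eq_bigl => p.
  rewrite /interlaced -/(chain p) andbAC andbC [RHS]andbC; congr (_ && _).
  apply/andP/forallP => [[_ /eqP pk] r|h].
    by apply/implyP => /eqP r0; rewrite (_ : r = ord0) ?pk //; exact/val_inj.
  have := h ord0; rewrite eqxx /= eqSS => /eqP/val_inj pk; split; last exact/eqP.
  apply/forallP => r; apply/implyP => /eqP r0.
  by rewrite (_ : r = ord0) ?pk //; exact/val_inj.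
by move=> p /andP[/forallP/(_ ord0)].
Qed.

Lemma Q_rec1 (j : 'I_n) : Q 1 j.+1 H = \sum_(i < n | (j <= i)%N) H i j.
Proof.
rewrite Q_head; apply: eq_bigr => i _.
rewrite (eq_bigl xpredT) => [|p]; last by apply/andP; split; [|apply/andP; split];
  apply/forallP => -[].
rewrite (eq_bigr (fun=> 1)) => [|p _]; last by rewrite /weight big_ord0.
by rewrite sumr_const cardT /= -cardE card_prod !card_ffun !card_ord expn0 mulr1.
Qed.

(** Split off the head pair [(i(1), j(1))] and sort the remaining chains by [j(2)], which may be any
    index beyond [i(1)]. *)
Lemma Q_rec m (j : 'I_n) : Q m.+2 j.+1 H =
  \sum_(i < n | (j <= i)%N) H i j * \sum_(k < n | (i < k)%N) Q m.+1 k.+1 H.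
Proof. by rewrite Q_head; apply: eq_bigr => i _; rewrite Q_tail. Qed.

(** The intervals from [j(r)] to [i(r)] are nonempty and disjoint, and only [n - j] indices are
    available to them. *)
Lemma Q_gt m (j : 'I_n) : (n - j < m)%N -> Q m j.+1 H = 0.
Proof.
elim: m j => [|[|m] IH] j; first by [].
  by have := ltn_ord j; lia.
move=> jm; rewrite Q_rec big1 // => i ji; rewrite big1 ?mulr0 // => k ik.
by apply: IH; move: (ltn_ord k); lia.
Qed.

(** The expansion in powers of [1 - 'X] starts at [m = 1] because [p_j] vanishes at [1] for
    [j < n]. *)
Definition impulse_poly (j : nat) : {poly R} :=
  if j == n then 1
  else \sum_(1 <= m < n.+1) ((-1) ^+ m * Q m j.+1 H) *: (1 - 'X) ^+ m.

(** The recursion for [Q] is the impulse recursion read off in powers of [1 - 'X]: the factor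
    ['X - 1] raises [m] by one and flips the sign, and [Q_rec1] accounts for the summand [p n = 1]
    of the tails. *)
Lemma impulse_polyP : impulse n (ent H) impulse_poly.
Proof.
have E (j : 'I_n) : impulse_poly j =
    \sum_(m < n) ((-1) ^+ m.+1 * Q m.+1 j.+1 H) *: (1 - 'X) ^+ m.+1.
  by rewrite /impulse_poly ltn_eqF // big_add1 big_mkord.
split; first by rewrite /impulse_poly eqxx.
move=> j jn; rewrite (E (Ordinal jn)) /=.
pose q m j := ((-1) ^+ m.+1 * Q m.+1 j.+1 H) *: (1 - 'X : {poly R}) ^+ m.+1.
(* A vanishing term is added so that both sides have the same range after the shift of [m]. *)
have -> : \sum_(m < n) q m j = \sum_(m < n.+1) q m j.
  rewrite big_ord_recr /= /q (Q_gt (j := Ordinal jn)) ?mulr0 ?scale0r ?addr0 //=.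
  lia.
have tail (i : 'I_n) : \sum_(k < n.+1 | (i < k)%N) impulse_poly k =
    1 + \sum_(m < n) ((-1) ^+ m.+1 * \sum_(k < n | (i < k)%N) Q m.+1 k.+1 H)
         *: (1 - 'X) ^+ m.+1.
  rewrite big_mkcond big_ord_recr /= -big_mkcond /= ltn_ord /impulse_poly eqxx.
  rewrite addrC; congr (_ + _).
  rewrite (eq_bigr (fun k : 'I_n => \sum_(m < n) q m k)) => [|k ik]; last first.
    by rewrite -E.
  rewrite exchange_big /=; apply: eq_bigr => m _.
  by rewrite mulr_sumr scaler_suml.
under [X in _ = _ * X]eq_bigr => i _ do
  rewrite (ent_ord H i (Ordinal jn)) tail scalerDr scaler_sumr.
rewrite big_split /= mulrDr big_ord_recl /q (Q_rec1 (Ordinal jn)); congr (_ + _).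
  by rewrite expr1 mulN1r -scaler_suml scaleNr -scalerN opprB mulr_algr.
rewrite exchange_big /= mulr_sumr; apply: eq_bigr => m _.
rewrite (Q_rec _ (Ordinal jn)) /bump /= mulr_sumr scaler_suml mulr_sumr.
apply: eq_bigr => i ji.
have -> (a b : R) : ('X - 1) * (a *: (b *: (1 - 'X) ^+ m.+1)) =
    (- (a * b)) *: (1 - 'X) ^+ m.+2.
  by rewrite -!scalerAr scalerA scaleNr [in RHS]exprS -scalerN -mulNr opprB.
by congr (_ *: _); rewrite exprS mulN1r !mulNr mulrCA.
Qed.

Lemma coef_oneBX m b : ((1 - 'X : {poly R}) ^+ m)`_b = (-1) ^+ b * 'C(m, b)%:R.
Proof.
elim: m b => [|m IH] b.
  by rewrite expr0 coef1 bin0n; case: b => [|b]; rewrite ?expr0 ?mul1r ?mulr0.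
rewrite exprS mulrBl mul1r coefB coefXM !IH; case: b => [|b] /=.
  by rewrite !bin0 subr0.
by rewrite binS natrD exprS; ring.
Qed.

(** The source of the binomials in the certificates: the signs cancel in pairs, and Vandermonde's
    convolution remains; [m <= n] ensures that the truncation at degree [n] loses nothing. *)
Lemma pdot_oneBX l m : (m <= n)%N ->
  pdot n ((1 - 'X : {poly R}) ^+ l) ((1 - 'X) ^+ m) = 'C(l + m, m)%:R.
Proof.
move=> mn; rewrite -binomial.Vandermonde natr_sum /pdot.
rewrite (big_ord_widen n.+1 (fun b => ('C(l, b) * 'C(m, m - b))%:R)) //.
rewrite [RHS]big_mkcond /=; apply: eq_bigr => b _.
rewrite !coef_oneBX mulrACA -expr2 sqrr_sign mul1r -natrM ltnS.
by case: ifP => [bm|/negbT]; rewrite ?bin_sub // -ltnNge => /bin_small ->; rewrite muln0.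
Qed.

Lemma pdotZl c (p q : {poly R}) : pdot n (c *: p) q = c * pdot n p q.
Proof. by rewrite /pdot mulr_sumr; apply: eq_bigr => b _; rewrite coefZ mulrA. Qed.

Lemma pdot_suml I (r : seq I) (P : pred I) (F : I -> {poly R}) q :
  pdot n (\sum_(i <- r | P i) F i) q = \sum_(i <- r | P i) pdot n (F i) q.
Proof.
rewrite /pdot exchange_big; apply: eq_bigr => b _.
by rewrite coef_sum mulr_suml.
Qed.

Lemma lambda_starE k j : (j < k <= n)%N ->
  lambda_star H k.+1 j.+1 =
  - n.+1%:R * pdot n (impulse_poly j) (impulse_poly k).
Proof.
move=> /andP[jk kn]; rewrite /lambda_star eqSS mulNr -mulrN; case: eqP => [->|/eqP nk].
  (* For [k = n] the second polynomial is [1 = (1 - 'X)^0], so every binomial equals [1]. *)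
  rewrite /impulse_poly eqxx (ltn_eqF (leq_trans jk kn)) pdot_suml -sumrN.
  congr (_ * _); apply: eq_big_nat => m /andP[m0 mn].
  rewrite pdotZl -(expr0 (1 - 'X)) pdot_oneBX // bin0 mulr1.
  by case: m m0 mn => // m _ _; rewrite subn1 exprS mulN1r !mulNr opprK.
rewrite /impulse_poly (negPf nk) (ltn_eqF (leq_trans jk kn)) pdot_suml -sumrN.
congr (_ * _); apply: eq_big_nat => l /andP[l0 ln].
rewrite pdotZl pdotC pdot_suml mulr_sumr -sumrN.
apply: eq_big_nat => m /andP[m0 mn].
rewrite pdotZl pdotC pdot_oneBX //.
case: l m l0 ln m0 mn => // l [//|m] _ _ _ _.
set c := _%:R; rewrite (_ : (l.+1 + m.+1 - 1)%N = (l + m.+1)%N) ?exprD; last lia.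
by rewrite [(-1) ^+ l.+1]exprS; ring.
Qed.
End InterlacedSums.

(** * The negacyclic shift *)

Section LinearDynamics.
Variables (R : realType) (n : nat) (h : nat -> nat -> R) (p : nat -> {poly R}).
Hypothesis hp : impulse n h p.
Variables (V : lmodType R) (Z : {linear V -> V}).

Lemma iter_linD b u v : iter b Z (u + v) = iter b Z u + iter b Z v.
Proof. by elim: b => //= b ->; rewrite linearD. Qed.

Lemma iter_linZ b c u : iter b Z (c *: u) = c *: iter b Z u.
Proof. by elim: b => //= b ->; rewrite linearZ. Qed.

Lemma iter_lin0 b : iter b Z 0 = 0.
Proof. by elim: b => //= b ->; rewrite linear0. Qed.

Lemma coefcomb_lin (y e : nat -> V) b :
  coefcomb n p (fun j => y j - Z (y j) + e j) b =
  coefcomb n p y b - Z (coefcomb n p y b) + coefcomb n p e b.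
Proof.
rewrite /coefcomb linear_sum -sumrB -big_split /=; apply: eq_bigr => k _.
by rewrite scalerDr scalerBr [Z (_ *: _)]linearZZ.
Qed.

Variables (y e : nat -> V).
Let g j := y j - Z (y j) + e j.
Hypothesis hy : forall k, (k < n)%N ->
  y k.+1 = y k - \sum_(j < n | (j <= k)%N) h k j *: g j.

(** Since [g = y - Z y + e], the combination of the [g] is [X - Z X] plus that of the [e]; the [X]
    cancels against the left side of [coefcomb0], and likewise of [coefcombS] below. *)
Lemma coefcomb_rec0 : Z (coefcomb n p y 0) =
  (psum n p)`_0 *: y 0%N + coefcomb n p e 0 - g n.
Proof.
have := coefcomb0 hp hy; rewrite coefcomb_lin.
move: (coefcomb n p y 0) (Z _) => X ZX E; apply: (addrI (X - ZX)).
rewrite subrK {1}E; move: (X - ZX) => D.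
by rewrite (addrCA _ D) -(addrA D).
Qed.

Lemma coefcomb_recS b : Z (coefcomb n p y b.+1) = coefcomb n p y b +
  (((psum n p)`_b.+1 - (psum n p)`_b) *: y 0%N + coefcomb n p e b.+1).
Proof.
have := coefcombS hp hy b; rewrite coefcomb_lin.
move: (coefcomb n p y b.+1) (Z _) => X ZX /eqP; rewrite subr_eq => /eqP E.
apply: (addrI (X - ZX)); rewrite subrK {1}E; move: (X - ZX) => D.
by rewrite addrC (addrCA _ D) (addrCA _ D).
Qed.

(** In operator form, [g n = (1 - Z) psum(Z) y_0 + \sum_j p_j(Z) e_j]. The recursion is substituted
    into itself until [coefcomb n p y n.+1 = 0] is reached. *)
Lemma lastg_iter : g n =
  \sum_(b < n.+2) iter b Z (((1 - 'X) * psum n p)`_b *: y 0%N + coefcomb n p e b).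
Proof.
have E m : g n = \sum_(b < m.+1)
      iter b Z (((1 - 'X) * psum n p)`_b *: y 0%N + coefcomb n p e b) -
    iter m.+1 Z (coefcomb n p y m).
  elim: m => [|m ->].
    rewrite big_ord1 /= coefcomb_rec0 mulrBl mul1r coefB coefXM subr0.
    by rewrite subKr.
  rewrite [in RHS]big_ord_recr -addrA; congr (_ + _).
  rewrite (iterSr m.+1 Z (coefcomb n p y m.+1)) coefcomb_recS (iter_linD _ (coefcomb n p y m)) opprD.
  by rewrite mulrBl mul1r coefB coefXM addrCA subrr addr0.
rewrite (E n.+1) (coefcomb_ge hp _ (ltnSn n)).
by rewrite iter_lin0 subr0.
Qed.
End LinearDynamics.

Section NegacyclicShift.
Variables (R : realType) (n : nat).
Local Notation E := (euclid R n.+1).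

(** It sends each basis vector to the next and the last to minus the first, whence [Z^N = -1]. *)
Definition nshift (u : E) : E :=
  \row_i (if i == ord0 then - u 0 ord_max else u 0 (inord i.-1)).

Fact nshift_linear : linear nshift.
Proof.
by move=> c u v; apply/rowP => i; rewrite !mxE; case: eqP => _ //; rewrite opprD mulrN.
Qed.

HB.instance Definition _ := GRing.isLinear.Build R E E *:%R nshift nshift_linear.

Lemma nshift_isometry u v : edot (nshift u) (nshift v) = edot u v.
Proof.
rewrite /edot big_ord_recl [RHS]big_ord_recr /= addrC; congr (_ + _).
  by rewrite !mxE eqxx mulrNN.
apply: eq_bigr => i _; rewrite !mxE /=.
rewrite (_ : inord _ = widen_ord (leqnSn n) i) //.
by apply/val_inj; rewrite /= inordK /bump /= ?add1n ?add0n /=; have := ltn_ord i; lia.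
Qed.

Definition step (b : nat) : E := \row_i (-1) ^+ (i < b)%N.

Lemma iter_nshift_step b : (b <= n.+1)%N -> iter b nshift (step 0) = step b.
Proof.
elim: b => // b IH bn; rewrite /= IH; last exact: ltnW.
apply/rowP => i; rewrite !mxE; case: eqP => [->|/eqP i0] /=.
  by rewrite ltnNge -ltnS bn expr0.
have i1 : (0 < i)%N by rewrite lt0n; apply: contraNneq i0 => i0; exact/eqP/val_inj.
rewrite inordK; last by rewrite ltnS (leq_trans (leq_pred _)) ?leq_ord.
by case: (nat_of_ord i) i1.
Qed.

Lemma step_last : step n.+1 = - step 0.
Proof. by apply/rowP => i; rewrite !mxE ltn_ord. Qed.

Lemma step_diff (b : 'I_n.+1) : step b - step b.+1 = 2 *: 'e_b.
Proof.
apply/rowP => i; rewrite !mxE eqxx ltnS -val_eqE /=.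
by case: (ltngtP i b) => _; rewrite ?mulr0 ?mulr1 ?expr0 ?expr1 ?subrr // opprK.
Qed.

Lemma edot_step0 u : edot (step 0) u = \sum_i u 0 i.
Proof. by apply: eq_bigr => i _; rewrite mxE mul1r. Qed.

Lemma edot_step00 : edot (step 0) (step 0) = n.+1%:R.
Proof.
rewrite edot_step0 (eq_bigr (fun=> 1)) => [|i _]; last by rewrite mxE.
by rewrite sumr_const card_ord.
Qed.

End NegacyclicShift.

(** * Necessity of the certificates *)

Section Necessity.

Lemma trajectory_exists (V : Type) (G : nat -> (nat -> V) -> V) (y0 : V) :
  (forall k y z, (forall j, (j <= k)%N -> y j = z j) -> G k y = G k z) ->
  exists y : nat -> V, y 0%N = y0 /\ forall k, y k.+1 = G k y.
Proof.
move=> Gext.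
(* Course-of-values recursion: the table [t k] holds the trajectory up to index [k]. *)
pose t := fix t k : nat -> V := if k is k'.+1 then
  (fun i => if (i <= k')%N then t k' i else G k' (t k')) else (fun=> y0).
have tE k i : (i <= k)%N -> t k i = t i i.
  elim: k => [|k IH]; first by rewrite leqn0 => /eqP ->.
  rewrite leq_eqVlt => /orP[/eqP -> //|]; rewrite ltnS => ik /=.
  by rewrite ik IH.
exists (fun k => t k k); split=> // k /=; rewrite ltnn.
by apply: Gext => j jk; rewrite tE.
Qed.

Variables (R : realType) (n : nat) (H : 'M[R]_n) (p : nat -> {poly R}).
Hypotheses (HH : Hstar H) (hp : impulse n (ent H) p).

Lemma Hstar_euclid m (T : euclid R m -> euclid R m) z (y : nat -> euclid R m) :
  (forall u v, edot (T u - T v) (T u - T v) <= edot (u - v) (u - v)) ->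
  T z = z ->
  (forall k, (k < n)%N -> y k.+1 = y k -
     \sum_(j < n | (j <= k)%N) ent H k j *: (y j - T (y j))) ->
  edot (y n - T (y n)) (y n - T (y n)) <=
    4 * edot (y 0%N - z) (y 0%N - z) / n.+1%:R ^+ 2.
Proof.
move=> Tne Tz hy; rewrite -!euclid_normE.
apply: (HH.2 (euclid_hilbert R m) T z y) => //.
  move=> u v; rewrite -(@ler_pXn2r _ 2) ?nnegrE //.
  by have := Tne u v; rewrite -!euclid_normE.
move=> k; rewrite (hy k (ltn_ord k)); congr (_ - _).
by apply: eq_bigr => j _; rewrite ent_ord.
Qed.

Lemma linear_trajectory (V : lmodType R) (Z : V -> V) (y0 : V) (e : nat -> V) :
  exists y : nat -> V, y 0%N = y0 /\ forall k, (k < n)%N -> y k.+1 = y k -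
     \sum_(j < n | (j <= k)%N) ent H k j *: (y j - Z (y j) + e j).
Proof.
have [|y [y00 hy]] := @trajectory_exists V (fun k y => y k -
     \sum_(j < n | (j <= k)%N) ent H k j *: (y j - Z (y j) + e j)) y0.
  by move=> k y z yz; rewrite yz //; congr (_ - _); apply: eq_bigr => j jk; rewrite yz.
by exists y; split=> // k _; rewrite hy.
Qed.

Local Notation E := (euclid R n.+1).
Local Notation Z := (@nshift R n).

Lemma psum_root1 : (psum n p).[1] = 1.
Proof.
rewrite horner_sum big_ord_recr /= big1 ?add0r => [|k _].
  by rewrite (impulse_root1 hp) // eqxx.
by rewrite (impulse_root1 hp) 1?ltnW ?ltn_ord //= ltn_eqF.
Qed.

(** Summation by parts moves the factor [1 - 'X] onto the orbit, where consecutive points differ by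
    [2 *: 'e_b]. *)
Lemma sum_iter_step :
  \sum_(b < n.+2) iter b Z (((1 - 'X) * psum n p)`_b *: step R n 0) =
  \sum_(b < n.+1) (2 * (psum n p)`_b) *: 'e_b.
Proof.
under eq_bigr => b _ do rewrite iter_linZ.
rewrite (eq_bigr (fun b : 'I_n.+2 => ((1 - 'X) * psum n p)`_b *: step R n b)); last first.
  by move=> b _; rewrite iter_nshift_step // leq_ord.
under eq_bigr => b _ do rewrite mulrBl mul1r coefB coefXM scalerBl.
rewrite sumrB big_ord_recr /= [X in _ - X]big_ord_recl /= scale0r add0r.
rewrite nth_default ?size_psum //; last exact: size_psum hp.
rewrite scale0r addr0 -sumrB; apply: eq_bigr => b _.
by rewrite -scalerBr step_diff scalerA mulrC.
Qed.

(** On the orbit of the shift the last residual has coordinates [2 psum_b]; the rate bounds the sum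
    of the [psum_b^2] by [1 / N], while the [psum_b] sum to [1]. *)
Lemma flat_of_Hstar : flat n p.
Proof.
have [y [y0 hy]] := linear_trajectory Z (step R n 0) (fun=> 0).
have e0 b : coefcomb n p (fun=> 0 : E) b = 0.
  by rewrite /coefcomb big1 // => k _; rewrite scaler0.
have gn : y n - Z (y n) = \sum_(b < n.+1) (2 * (psum n p)`_b) *: 'e_b.
  have := lastg_iter hp (Z := Z) (e := fun=> 0) hy; rewrite addr0 => ->.
  by under eq_bigr => b _ do rewrite e0 addr0 y0; exact: sum_iter_step.
have gnE (i : 'I_n.+1) : (y n - Z (y n)) 0 i = 2 * (psum n p)`_i.
  rewrite gn summxE (bigD1 i) //= big1 => [|b bi].
    by rewrite !mxE !eqxx mulr1 addr0.
  by rewrite !mxE eqxx eq_sym (negPf bi) mulr0.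
have N0 : (0 : R) < n.+1%:R by rewrite ltr0n.
have bound : edot (y n - Z (y n)) (y n - Z (y n)) <= 4 * n.+1%:R / n.+1%:R ^+ 2.
  rewrite -[X in 4 * X](edot_step00 R n) -y0 -[y 0%N]subr0.
  apply: (@Hstar_euclid n.+1 Z 0 y) => [u v||k kn].
  - by rewrite -linearB nshift_isometry.
  - by rewrite linear0.
  by rewrite hy //; congr (_ - _); apply: eq_bigr => j _; rewrite addr0.
have sum1 : \sum_(i < n.+1) (psum n p)`_i = 1.
  rewrite -psum_root1 (horner_coef_wide _ (size_psum hp)).
  by apply: eq_bigr => i _; rewrite expr1n mulr1.
(* Equality case of the Cauchy-Schwarz inequality. *)
have sq : \sum_(i < n.+1) ((psum n p)`_i - n.+1%:R^-1) ^+ 2 <= 0.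
  have -> : \sum_(i < n.+1) ((psum n p)`_i - n.+1%:R^-1) ^+ 2 =
      4^-1 * edot (y n - Z (y n)) (y n - Z (y n)) - n.+1%:R^-1.
    under eq_bigr => i _ do rewrite sqrrB -mulrnAl.
    rewrite big_split sumrB /= -mulr_suml sumrMnl sum1 sumr_const card_ord.
    rewrite /edot mulr_sumr; under [in RHS]eq_bigr => i _ do rewrite gnE.
    have -> : \sum_(i < n.+1) 4^-1 * (2 * (psum n p)`_i * (2 * (psum n p)`_i)) =
       \sum_(i < n.+1) (psum n p)`_i ^+ 2.
      by apply: eq_bigr => i _; field.
    by rewrite -mulr_natr; field; rewrite nat1r pnatr_eq0.
  rewrite subr_le0 ler_pdivrMl ?ltr0n // (le_trans bound) //.
  by rewrite le_eqVlt; apply/orP; left; apply/eqP; field; rewrite nat1r pnatr_eq0.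
apply/polyP => i; rewrite coef_poly; case: ltnP => [iN|Ni]; last first.
  by rewrite nth_default // (leq_trans (size_psum hp)).
move: sq; rewrite le_eqVlt ltNge sumr_ge0 ?orbF => [|j _]; last exact: sqr_ge0.
rewrite psumr_eq0 => [/allP sq|j _]; last exact: sqr_ge0.
have := sq (Ordinal iN); rewrite mem_index_enum sqrf_eq0 subr_eq0 => /(_ isT)/eqP.
exact.
Qed.

Section Probe.
Variable x : nat -> E.
Hypothesis x0 : x 0%N = step R n 0.
Hypothesis hx : forall k, (k < n)%N -> x k.+1 = x k -
     \sum_(j < n | (j <= k)%N) ent H k j *: (x j - Z (x j)).

Let hx0 k : (k < n)%N -> x k.+1 = x k -
     \sum_(j < n | (j <= k)%N) ent H k j *: (x j - Z (x j) + 0).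
Proof.
by move=> kn; rewrite hx //; congr (_ - _); apply: eq_bigr => j _; rewrite addr0.
Qed.

(** By flatness the recursion has no source term between degrees [0] and [n]; run downwards from
    degree [n], it applies the shift once per degree. *)
Lemma coefcomb_orbit c : (c <= n)%N ->
  coefcomb n p x (n - c) = n.+1%:R^-1 *: step R n c.
Proof.
have e0 b : coefcomb n p (fun=> 0 : E) b = 0.
  by rewrite /coefcomb big1 // => k _; rewrite scaler0.
have rec b := coefcomb_recS hp (Z := Z) (e := fun=> 0) hx0 b.
move=> cn; rewrite -iter_nshift_step ?(leq_trans cn) //.
elim: c cn => [_|c IH cn].
  have := rec n; rewrite (coefcomb_ge hp _ (ltnSn n)) linear0 e0 addr0 subn0.
  rewrite flat_of_Hstar !coef_poly ltnn ltnSn sub0r x0 scaleNr => /esym/eqP.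
  by rewrite subr_eq0 => /eqP.
have := rec (n - c.+1)%N; rewrite -subSn // subSS e0 addr0 flat_of_Hstar.
rewrite !coef_poly !ltnS !leq_subr subrr scale0r addr0 IH 1?ltnW // => <-.
by rewrite linearZ.
Qed.

Lemma edot_iter b (u v : E) : edot (iter b Z u) (iter b Z v) = edot u v.
Proof. by elim: b => //= b <-; rewrite nshift_isometry. Qed.

(** The isometry [Z^(b+1)] takes [coefcomb n p x b], which is [Z^(n-b)] of the starting vector over
    [N], to minus the starting vector over [N]. *)
Lemma edot_orbit b (a : E) : (b <= n)%N ->
  edot (step R n 0) (iter b.+1 Z a) =
  - n.+1%:R * \sum_(k < n.+1) (p k)`_b * edot (x k) a.
Proof.
move=> bn.
have -> : \sum_(k < n.+1) (p k)`_b * edot (x k) a = edot (coefcomb n p x b) a.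
  by rewrite /coefcomb edot_suml; apply: eq_bigr => k _; rewrite edotZl.
have -> : coefcomb n p x b = n.+1%:R^-1 *: step R n (n - b).
  by rewrite -coefcomb_orbit ?leq_subr // subKn.
rewrite -(edot_iter b.+1 (_ *: _)).
rewrite iter_linZ -(@iter_nshift_step _ _ (n - b)); last by rewrite leqW ?leq_subr.
rewrite -iterD addSn subnKC // iter_nshift_step // step_last edotZl edotNl.
by rewrite mulrN mulrNN mulVKf // pnatr_eq0.
Qed.

(** Combinations of the iterates give all the vectors [step c], whose differences are the doubled
    basis vectors; hence the [n + 1] iterates form a basis and their products with [a] can be
    prescribed. *)
Lemma orbit_basis (t : nat -> R) :
  exists a : E, forall k, (k <= n)%N -> edot (x k) a = t k.
Proof.
pose M : 'M[R]_n.+1 := \matrix_(i, k) x k 0 i.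
have ME (v : 'rV[R]_n.+1) (k : 'I_n.+1) : (v *m M) 0 k = edot (x k) v.
  by rewrite !mxE; apply: eq_bigr => i _; rewrite mxE mulrC.
have MU : M \in unitmx.
  rewrite -row_free_unit -kermx_eq0; apply/rowV0P => v /sub_kermxP vM.
  have xv (k : 'I_n.+1) : edot (x k) v = 0 by rewrite -ME vM mxE.
  have sv c : (c <= n.+1)%N -> edot (step R n c) v = 0.
    rewrite leq_eqVlt => /orP[/eqP ->|]; last rewrite ltnS => cn; last first.
      apply: (@mulfI _ n.+1%:R^-1); first by rewrite invr_eq0 pnatr_eq0.
      rewrite mulr0 -edotZl -coefcomb_orbit // /coefcomb edot_suml big1 // => k _.
      by rewrite edotZl xv mulr0.
    rewrite step_last edotNl.
    have -> : edot (step R n 0) v = 0; last by rewrite oppr0.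
    by rewrite -x0 (xv ord0).
  apply/rowP => i; rewrite mxE.
  have : edot (2 *: 'e_i : E) v = 0.
    by rewrite -step_diff edotBl !sv ?subrr // ltnW.
  rewrite edotZl /edot (bigD1 i) //= big1 => [|j ji].
    by rewrite mxE !eqxx mul1r addr0 => /eqP; rewrite mulf_eq0 pnatr_eq0 => /eqP.
  by rewrite mxE eqxx (negPf ji) mul0r.
exists ((\row_k t k) *m invmx M) => k kn.
by rewrite -(ME _ (Ordinal (kn : (k < n.+1)%N))) mulmxKV // mxE.
Qed.

End Probe.

(* A ridge perturbation of the identity: it moves along [a] exactly the points
   [u] with [edot a u <= -2], by [eps *: a], and fixes those with
   [-1 <= edot a u]. *)
Definition clamp (t : R) : R :=
  if -1 <= t then 0 else if t <= -2 then -1 else t + 1.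

Lemma clamp0 t : -1 <= t -> clamp t = 0.
Proof. by rewrite /clamp => ->. Qed.

Lemma clampN1 t : t <= -2 -> clamp t = -1.
Proof. by rewrite /clamp => t2; rewrite t2; case: ifP => // ?; lra. Qed.

(** [clamp] is nondecreasing and 1-Lipschitz. *)
Lemma clamp_sqr s t : (clamp s - clamp t) ^+ 2 <= (clamp s - clamp t) * (s - t).
Proof.
have mono u v : v <= u -> 0 <= clamp u - clamp v <= u - v.
  rewrite /clamp => vu; case: (lerP (-1) u); case: (lerP (-1) v);
  case: (lerP u (-2)); case: (lerP v (-2)); lra.
have [ts|/ltW st] := leP t s.
  by have /andP[? ?] := mono _ _ ts; rewrite expr2 ler_wpM2l.
rewrite -sqrrN -mulrNN !opprB.
by have /andP[? ?] := mono _ _ st; rewrite expr2 ler_wpM2l.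
Qed.

Definition ridge (eps : R) (a u : E) : E := u - (eps * clamp (edot a u)) *: a.

(** With [w = u - v] and [c] the difference of the clamps, the square changes by
    [- 2 eps c <w,a> + eps^2 c^2 |a|^2], which is at most [- 2 eps c^2 + eps c^2]. *)
Lemma ridge_nonexpansive eps a u v : 0 <= eps -> eps * edot a a <= 1 ->
  edot (ridge eps a u - ridge eps a v) (ridge eps a u - ridge eps a v) <=
  edot (u - v) (u - v).
Proof.
move=> e0 ea; set c := clamp (edot a u) - clamp (edot a v).
have -> : ridge eps a u - ridge eps a v = (u - v) - (eps * c) *: a.
  rewrite /c /ridge mulrBr scalerBl !opprB addrACA [RHS]addrACA; congr (_ + _).
  by rewrite addrC.
have : c ^+ 2 <= c * edot (u - v) a by rewrite edotBl !(edotC _ a) clamp_sqr.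
move: (u - v) => w cw.
rewrite !(edotBl, edotBr, edotZl, edotZr) (edotC a w) -subr_ge0.
have h0 := mulr_ge0 (sqr_ge0 c) e0.
have h1 := ler_wpM2l e0 cw; have h2 := ler_wpM2l h0 ea.
by move: h0 h1 h2; rewrite mulr1; lra.
Qed.

Lemma pdot_Hstar_lt j0 k0 : (j0 < n)%N -> (k0 <= n)%N -> k0 != j0 ->
  pdot n (p j0) (p k0) <= 0.
Proof.
move=> j0n k0n k0j0; have fp := flat_of_Hstar.
(* The vector [a] below separates [x k0], [x j0] and the other iterates of the
   shift at heights [L], [-3] and [0], so the ridge map only moves [x j0]; the
   weight of the inequality between [k0] and [j0] is proportional to [L + 3]. *)
suff key L : 0 <= L -> L * pdot n (p j0) (p k0) <= 3 * pdot n (p j0) (p j0).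
  rewrite leNgt; apply/negP => G0.
  have D0 : 0 <= pdot n (p j0) (p j0).
    by apply: sumr_ge0 => b _; rewrite -expr2 sqr_ge0.
  (* For this [L] the left side of [key] would be [3 <p_j0, p_j0> + 1]. *)
  have /key : 0 <= (3 * pdot n (p j0) (p j0) + 1) / pdot n (p j0) (p k0).
    by apply: divr_ge0; [rewrite addr_ge0 ?mulr_ge0 | exact: ltW].
  by rewrite divfK ?gt_eqF //; lra.
move=> L0.
have [x [x0 hx]] := linear_trajectory Z (step R n 0) (fun=> 0).
have {}hx k : (k < n)%N -> x k.+1 = x k -
     \sum_(j < n | (j <= k)%N) ent H k j *: (x j - Z (x j)).
  by move=> kn; rewrite hx //; congr (_ - _); apply: eq_bigr => j _; rewrite addr0.
pose t k : R := if k == k0 then L else if k == j0 then -3 else 0.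
have [a xa] := orbit_basis x0 hx t.
(* The response of the linear iteration to a unit disturbance at step [j0]; as long as the clamps
   keep their values, [x + eps *: w] is the exact perturbed trajectory. *)
have [w [w0 hw]] := linear_trajectory Z 0 (fun j => - ((j == j0)%:R *: Z a)).
(* Small enough for the ridge map to be nonexpansive and for no height [edot a (y k)] to move by
   more than [1] from [t k]. *)
pose eps := (1 + edot a a + \sum_(k < n.+1) `|edot (w k) a|)^-1.
have den0 : 0 < 1 + edot a a + \sum_(k < n.+1) `|edot (w k) a|.
  by rewrite !ltr_wpDr ?edot_ge0 ?sumr_ge0.
have e0 : 0 < eps by rewrite invr_gt0.
have ea : eps * edot a a <= 1.
  rewrite ler_pdivrMl // mulr1 addrAC lerDr addr_ge0 // sumr_ge0 //.
have ew k : (k <= n)%N -> `|eps * edot (w k) a| <= 1.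
  move=> kn; rewrite normrM gtr0_norm // ler_pdivrMl // mulr1.
  rewrite (bigD1 (Ordinal (kn : (k < n.+1)%N))) //= addrCA lerDl.
  by rewrite !addr_ge0 ?edot_ge0 ?sumr_ge0.
pose y k := x k + eps *: w k.
pose T u := Z (ridge eps a u).
pose e k := - ((k == j0)%:R *: (eps *: Z a)).
have Ty k : (k <= n)%N -> y k - T (y k) = y k - Z (y k) + e k.
  move=> kn.
  (* The heights stay at least [L - 1] at [k0], at most [-2] at [j0] and at least [-1] elsewhere. *)
  have ck : clamp (edot a (y k)) = - (k == j0)%:R.
    rewrite edotC /y edotDl edotZl xa // /t.
    have := ew k kn; rewrite ler_norml => /andP[? ?].
    case: (k =P k0) => [kk|_].
      have -> : (k == j0) = false by rewrite kk (negPf k0j0).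
      by rewrite oppr0 clamp0 //; lra.
    case: eqP => _ /=; first by rewrite clampN1 //; lra.
    by rewrite oppr0 clamp0 //; lra.
  rewrite /T /ridge ck linearB opprB [_ - Z (y k)]addrC addrA; congr (_ + _).
  by rewrite linearZ /= /e scalerA mulrN scaleNr mulrC.
have hy k : (k < n)%N -> y k.+1 = y k -
     \sum_(j < n | (j <= k)%N) ent H k j *: (y j - Z (y j) + e j).
  move=> kn; rewrite /y hx // hw // scalerBr addrACA -opprD; congr (_ - _).
  rewrite scaler_sumr -big_split /=; apply: eq_bigr => j _.
  rewrite scalerA mulrC -scalerA -scalerDr; congr (_ *: _).
  have -> : Z (x j + eps *: w j) = Z (x j) + eps *: Z (w j).
    by rewrite linearD; congr (_ + _); rewrite linearZ.
  rewrite /e opprD scalerBr scalerBr addrA addrACA; congr (_ + _).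
  by rewrite !scalerA mulrC.
(* This is [Z p_j0(Z) a]; the disturbance adds [- eps *: d] to the last residual. *)
pose d := \sum_(b < n.+1) (p j0)`_b *: iter b.+1 Z a.
have gn : y n - Z (y n) + e n = (2 / n.+1%:R) *: step R n 0 - eps *: d.
  have := lastg_iter hp (Z := Z) (e := e) hy => ->.
  under eq_bigr => b _ do rewrite iter_linD /y x0 w0 scaler0 addr0.
  rewrite big_split /= sum_iter_step; congr (_ + _).
    rewrite fp; apply/rowP => i; rewrite summxE (bigD1 i) //= big1 => [|b bi].
      by rewrite !mxE !eqxx coef_poly ltn_ord !mulr1 addr0.
    by rewrite !mxE eqxx eq_sym (negPf bi) mulr0.
  have ce b : coefcomb n p e b = (- (eps * (p j0)`_b)) *: Z a.
    rewrite /coefcomb (bigD1 (Ordinal (ltnW j0n : (j0 < n.+1)%N))) //= big1.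
      by rewrite addr0 /e eqxx scale1r scalerN scalerA mulrC scaleNr.
    by move=> k; rewrite -val_eqE /= /e => /negPf ->; rewrite scale0r oppr0 scaler0.
  rewrite big_ord_recr /= ce nth_default ?mulr0 ?oppr0 ?scale0r ?iter_lin0 ?linear0 ?addr0; last first.
    by apply: (leq_trans (size_impulse hp (ltnW j0n))); lia.
  rewrite /d scaler_sumr -sumrN; apply: eq_bigr => b _.
  by rewrite ce iter_linZ -iterSr scalerA scaleNr.
have ds : edot (step R n 0) d =
    - n.+1%:R * (L * pdot n (p j0) (p k0) - 3 * pdot n (p j0) (p j0)).
  rewrite /d edot_sumr.
  under eq_bigr => b _ do rewrite edotZr (edot_orbit x0 hx) ?leq_ord //.
  under eq_bigr => b _ do rewrite mulrCA mulr_sumr.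
  rewrite -mulr_sumr exchange_big /=; congr (_ * _).
  have k0N : (k0 < n.+1)%N by []; have j0N : (j0 < n.+1)%N by exact: ltnW.
  rewrite (bigD1 (Ordinal k0N)) // (bigD1 (Ordinal j0N)) /=; last first.
    by rewrite -val_eqE /= eq_sym.
  rewrite addrA [X in _ + X]big1 ?addr0 => [|k]; last first.
    rewrite -!val_eqE /= => /andP[kk0 kj0]; apply: big1 => b _.
    by rewrite xa ?leq_ord // /t (negPf kk0) (negPf kj0) !mulr0.
  rewrite !xa // ?(ltnW j0n) // /t !eqxx [j0 == k0]eq_sym (negPf k0j0) /pdot !mulr_sumr.
  by rewrite -sumrN; congr (_ + _); apply: eq_bigr => b _; ring.
have : edot (y n - T (y n)) (y n - T (y n)) <= 4 * n.+1%:R / n.+1%:R ^+ 2.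
  rewrite -[X in 4 * X](edot_step00 R n) -x0 -[x 0%N]subr0.
  have -> : x 0%N = y 0%N by rewrite /y w0 scaler0 addr0.
  apply: (@Hstar_euclid n.+1 T 0 y) => [u v||k kn].
  - by rewrite /T -linearB nshift_isometry ridge_nonexpansive // ltW.
  - by rewrite /T /ridge edotC -(scale0r a) edotZl mul0r clamp0 ?lerN10 // mulr0 scale0r subr0 linear0.
  rewrite hy //; congr (_ - _); apply: eq_bigr => j jk.
  by rewrite Ty // (leq_trans jk) // ltnW.
rewrite Ty // gn !(edotBl, edotBr, edotZl, edotZr) edot_step00 (edotC d) ds.
set N := n.+1%:R; set Gk := pdot n (p j0) (p k0); set Gj := pdot n (p j0) (p j0).
have N0 : 0 < N by rewrite ltr0n.
set A := (X in X <= _).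
have -> : A = 4 * N / N ^+ 2 + eps * (4 * (L * Gk - 3 * Gj) + eps * edot d d).
  by rewrite /A; field; rewrite gt_eqF.
(* The rate leaves [4 (L Gk - 3 Gj) + eps |d|^2 <= 0]; the last term is nonnegative, so no limit in
   [eps] has to be taken. *)
rewrite gerDl pmulr_rle0 // => h.
have := mulr_ge0 (ltW e0) (edot_ge0 d); lra.
Qed.

Lemma pdot_Hstar j k : (j <= n)%N -> (k <= n)%N -> j != k ->
  pdot n (p j) (p k) <= 0.
Proof.
move=> jn kn; have [jk _|kj _|-> /eqP //] := ltngtP j k.
  by apply: pdot_Hstar_lt; rewrite ?(leq_trans jk) // gtn_eqF.
by rewrite pdotC; apply: pdot_Hstar_lt; rewrite ?(leq_trans kj) // gtn_eqF.
Qed.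

End Necessity.

(** * Polynomial families with one member of each degree *)

Section TriangularBasis.
Variables (R : realType) (B : nat -> {poly R}) (m : nat).
Hypothesis sB : forall d, (d < m)%N -> (size (B d) <= d.+1)%N.
Hypothesis lB : forall d, (d < m)%N -> (B d)`_d != 0.

Lemma triangular_span (W : {poly R}) : (size W <= m)%N ->
  exists x : nat -> R, W = \sum_(d < m) x d *: B d.
Proof.
elim: m sB lB W => [|k IH] sB' lB' W sW.
  by exists (fun=> 0); rewrite big_ord0; apply/eqP; rewrite -size_poly_leq0.
pose a := W`_k / (B k)`_k.
have [|||x Wx] := IH _ _ (W - a *: B k).
- by move=> d dk; apply: sB'; exact: ltnW.
- by move=> d dk; apply: lB'; exact: ltnW.
- apply/leq_sizeP => i ki; rewrite coefB coefZ.
  have [->|ik] := eqVneq i k; first by rewrite divfK ?lB' ?subrr.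
  have ki' : (k.+1 <= i)%N by rewrite ltn_neqAle eq_sym ik.
  by rewrite !nth_default ?mulr0 ?subr0 // (leq_trans _ ki') // sB'.
exists (fun d => if d == k then a else x d).
rewrite big_ord_recr /= eqxx -[LHS](subrK (a *: B k)) Wx; congr (_ + _).
by apply: eq_bigr => d _; rewrite (ltn_eqF (ltn_ord d)).
Qed.

Lemma triangular_free (x : nat -> R) : \sum_(d < m) x d *: B d = 0 ->
  forall d, (d < m)%N -> x d = 0.
Proof.
elim: m sB lB => // k IH sB' lB'; rewrite big_ord_recr /= => S0.
have xk : x k = 0.
  have := congr1 (fun p : {poly R} => p`_k) S0.
  rewrite /= coefD coefZ coef_sum big1 ?add0r ?coef0 => [/eqP|d _].
    by rewrite mulf_eq0 (negPf (lB' k _)) // orbF => /eqP.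
  by rewrite coefZ nth_default ?mulr0 // (leq_trans (sB' d _)) ?ltn_ord // ltnS ltnW.
move=> d; rewrite ltnS leq_eqVlt => /orP[/eqP -> //|dk].
apply: IH dk => [d' ?|d' ?|]; [exact/sB'/ltnW|exact/lB'/ltnW|].
by move: S0; rewrite xk scale0r addr0.
Qed.

End TriangularBasis.

(** * Expansions in powers of [1 - 'X] and the column of the node [N'] *)

Section OneMinusX.
Variable R : realType.

Lemma oneBX_coef_inj M (a b : nat -> R) :
  \sum_(m < M) a m *: (1 - 'X : {poly R}) ^+ m = \sum_(m < M) b m *: (1 - 'X) ^+ m ->
  forall m, (m < M)%N -> a m = b m.
Proof.
have C (u : nat -> R) :
    (\sum_(m < M) u m *: (1 - 'X : {poly R}) ^+ m) \Po (1 - 'X) = \poly_(m < M) u m.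
  rewrite poly_def raddf_sum; apply: eq_bigr => m _ /=.
  by rewrite comp_polyZ rmorphXn /= comp_polyB -polyC1 comp_polyC comp_polyX subKr.
move=> /(congr1 (fun q => q \Po (1 - 'X))); rewrite !C => E m mM.
by have := congr1 (fun q : {poly R} => q`_m) E; rewrite !coef_poly mM.
Qed.

Definition flatpoly k : {poly R} := \poly_(b < k.+1) k.+1%:R^-1.

Lemma mul_flatpoly k : ('X - 1) * flatpoly k = k.+1%:R^-1 *: ('X^(k.+1) - 1).
Proof.
rewrite /flatpoly poly_def -scaler_sumr -scalerAr subrX1; congr (_ *: _).
Qed.

(** With [k + 1 = N - N'], these coefficients are, up to sign and the factor [N' / N], the values
    prescribed for [Q(m, N')]. Pascal-type identities combine the expansions of the two terms. *)
Lemma subX_flatpoly k : 'X^(k.+1) - flatpoly k =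
  \sum_(1 <= m < k.+2) ((-1) ^+ m * (k.+2%:R / m.+1%:R * 'C(k, m.-1)%:R))
     *: (1 - 'X) ^+ m.
Proof.
have X1 : ('X - 1 : {poly R}) != 0 by rewrite -polyC1 polyXsubC_eq0.
have XE j : 'X^j = \sum_(m < j.+1) ((-1) ^+ m * 'C(j, m)%:R) *: (1 - 'X : {poly R}) ^+ m.
  have {1}-> : 'X = 1 - (1 - 'X) :> {poly R} by rewrite subKr.
  rewrite exprBn; apply: eq_bigr => m _.
  rewrite expr1n mulr1 [in RHS]mulrC -scalerA scaler_nat; congr (_ *+ _).
  by rewrite -mul_polyC rmorph_sign.
have FE : flatpoly k = \sum_(m < k.+2) ((-1) ^+ m * ('C(k.+1, m.+1)%:R / k.+1%:R))
     *: (1 - 'X : {poly R}) ^+ m.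
  apply: (mulfI X1); rewrite mul_flatpoly XE big_ord_recl /= bin0 mulr1 scale1r addrC addKr.
  rewrite [in RHS]big_ord_recr /= bin_small // mul0r mulr0 scale0r addr0 scaler_sumr mulr_sumr.
  apply: eq_bigr => m _; rewrite /bump /= add1n -scalerAr scalerA.
  have -> : ('X - 1) * (1 - 'X) ^+ m = - (1 - 'X : {poly R}) ^+ m.+1.
    by rewrite exprS -mulNr opprB.
  by rewrite scalerN -scaleNr; congr (_ *: _); rewrite exprS; ring.
rewrite FE XE -sumrB big_ord_recl /= bin1 divff ?pnatr_eq0 // bin0 subrr add0r.
rewrite big_add1 big_mkord; apply: eq_bigr => m _.
rewrite /bump /= add1n -scalerBl -mulrBr; congr (_ * _ *: _).
have h1 : (m.+1)%:R * 'C(k.+1, m.+1)%:R = k.+1%:R * 'C(k, m)%:R :> R.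
  by rewrite -!natrM mul_bin_diag.
have h2 : (m.+2)%:R * 'C(k.+1, m.+2)%:R = (k%:R - m%:R) * 'C(k.+1, m.+1)%:R :> R.
  rewrite -natrM mul_bin_left natrM natrB ?ltn_ord // -!natr1; congr (_ * _); ring.
have nz j : (j.+1%:R : R) != 0 by rewrite pnatr_eq0.
have -> : 'C(k.+1, m.+2)%:R = (k%:R - m%:R) * 'C(k.+1, m.+1)%:R / m.+2%:R :> R.
  by rewrite -h2 mulrC mulKf.
have -> : 'C(k.+1, m.+1)%:R = k.+1%:R * 'C(k, m)%:R / m.+1%:R :> R.
  by rewrite -h1 mulrC mulKf.
move: (nat_of_ord m) => {h1 h2}{}m.
have := nz m; have := nz m.+1; have := nz k.
rewrite -[k.+2]addn2 -[m.+2]addn2 -[m.+1]addn1 -[k.+1]addn1 !natrD.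
by move=> ? ? ?; field; apply/and3P; split.
Qed.
End OneMinusX.

Section QPoly.
Variables (R : realType) (n n1 k : nat) (H : 'M[R]_n) (c : R).
Hypothesis nk : n = (n1 + k).+1.

(** Powers of [1 - 'X] are independent, so the prescribed values of [Q] amount to one polynomial
    identity; for [m > k + 1] both coefficients vanish, that of [impulse_poly] by [Q_gt]. *)
Lemma impulse_poly_eqQ :
  impulse_poly H n1 = c *: ('X^(k.+1) - flatpoly R k) <->
  forall m, (1 <= m <= k.+1)%N ->
    Q m n1.+1 H = c * (k.+2%:R / m.+1%:R * 'C(k, m.-1)%:R).
Proof.
have n1n : (n1 < n)%N by lia.
pose u m : R := (m != 0%N)%:R * ((-1) ^+ m * Q m n1.+1 H).
pose v m : R := (1 <= m <= k.+1)%:R *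
  ((-1) ^+ m * (c * (k.+2%:R / m.+1%:R * 'C(k, m.-1)%:R))).
have E1 : impulse_poly H n1 = \sum_(m < n.+1) u m *: (1 - 'X) ^+ m.
  rewrite /u /impulse_poly ltn_eqF // big_ord_recl /= mul0r scale0r add0r.
  by rewrite big_add1 big_mkord; apply: eq_bigr => m _; rewrite mul1r.
have E2 : c *: ('X^(k.+1) - flatpoly R k) =
    \sum_(m < n.+1) v m *: (1 - 'X) ^+ m.
  rewrite /v subX_flatpoly scaler_sumr big_add1 big_mkord.
  rewrite [in RHS]big_ord_recl /= mul0r scale0r add0r.
  rewrite (big_ord_widen n (fun m => c *: (((-1) ^+ m.+1 * (k.+2%:R / m.+2%:R * 'C(k, m)%:R)) *: (1 - 'X) ^+ m.+1))); last lia.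
  rewrite big_mkcond; apply: eq_bigr => m _.
  rewrite /bump /= add1n ltnS; case: ifP => _; last by rewrite mul0r scale0r.
  by rewrite mul1r scalerA; congr (_ *: _); ring.
split=> [E m mk|E].
  have {}E := E; rewrite E1 E2 in E.
  have /(_ m) := oneBX_coef_inj E.
  rewrite /u /v mk -lt0n; case/andP: mk => m0 mk; rewrite m0 !mul1r => h.
  by apply: (@mulfI _ ((-1) ^+ m)); [rewrite signr_eq0 | apply: h; lia].
rewrite E1 E2; apply: eq_bigr => m _; congr (_ *: _); rewrite /u /v.
case: (leqP 1 m) => [m0|m0]; last by rewrite (_ : m = 0 :> nat) /= ?mul0r //; lia.
rewrite -lt0n m0 /=; case: (leqP m k.+1) => mk.
  by rewrite E ?m0.
by rewrite (@Q_gt _ _ _ _ (Ordinal n1n)) ?mulr0 ?mul0r //=; lia.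
Qed.
End QPoly.

(** * Gluing *)

Lemma impulse_natP (R : realType) n (h : nat -> nat -> R) p :
  impulse n h p <-> p n = 1 /\ forall j, (j < n)%N -> p j =
    ('X - 1) * \sum_(j <= i < n) h i j *: \sum_(i.+1 <= k < n.+1) p k.
Proof.
have E j : \sum_(i < n | (j <= i)%N) h i j *: \sum_(k < n.+1 | (i < k)%N) p k =
  \sum_(j <= i < n) h i j *: \sum_(i.+1 <= k < n.+1) p k.
  by rewrite big_geq_mkord; apply: eq_bigr => i _; rewrite big_geq_mkord.
by split=> -[pn hp]; split=> // j jn; rewrite hp // E.
Qed.

Lemma psum_nat (R : realType) n (p : nat -> {poly R}) :
  psum n p = \sum_(0 <= k < n.+1) p k.
Proof. by rewrite big_mkord. Qed.

Section Gluing.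
Variables (R : realType) (N N' : nat).
Hypothesis hN' : (1 <= N' <= N.-1)%N.
Local Notation n := (N.-1).
Local Notation n1 := (N'.-1).
Local Notation n2 := ((N - N').-1).
Variables (H1 : 'M[R]_n1) (H2 : 'M[R]_n2).
Implicit Type H : 'M[R]_n.

Let c : R := N'%:R / N%:R.
Let d : R := (N - N')%:R / N%:R.

Let N0 : N%:R != 0 :> R. Proof. by rewrite pnatr_eq0; lia. Qed.

Let cd : c + d = 1.
Proof. by rewrite /c /d -mulrDl -natrD subnKC ?divff //; lia. Qed.

Let nE : n = (n1 + n2).+1. Proof. lia. Qed.
Let n2E : (N - N')%N = n2.+1. Proof. lia. Qed.
Let n1E : N' = n1.+1. Proof. lia. Qed.
Let n1n : (n1 < n)%N. Proof. lia. Qed.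

(** The node [N'] has 0-based index [n1]. Its column from the diagonal down is left to
    [glued_column]. *)
Record glued_entries H : Prop := GluedEntries {
  glued_trig : is_trig_mx H;
  glued_11 : forall i j, (j <= i)%N -> (i < n1)%N -> ent H i j = ent H1 i j;
  glued_22 : forall i j, (j <= i)%N -> (i < n2)%N ->
    ent H (i + N') (j + N') = ent H2 i j;
  glued_21 : forall i j, (j < n1)%N -> (n1 < i < n)%N -> ent H i j = 0;
  glued_row : forall j, (j < n1)%N ->
    ent H n1 j = - d * \sum_(j <= k < n1) ent H1 k j }.

Definition glued_column H :=
  impulse_poly H n1 = c *: ('X^(n2.+1) - flatpoly R n2).

Lemma is_gluedE H : is_glued H1 H2 H <->
  [/\ glued_entries H, ent H n1 n1 = c * (N - N')%:R & glued_column H].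
Proof.
have col : glued_column H <-> forall m, (1 <= m <= N - N')%N ->
    Q m N' H = N'%:R * (N - N' + 1)%:R / (N%:R * (m + 1)%:R)
            * 'C((N - N' - 1)%N, (m - 1)%N)%:R.
  rewrite /glued_column (impulse_poly_eqQ H c nE) -n1E -n2E.
  split=> h m hm; have := h m hm; rewrite !subn1 !addn1 => ->;
  by rewrite /c invfM; ring.
have diag : (ent H n1 n1 = c * (N - N')%:R) <->
    (entry H N' N' = N'%:R * (N - N')%:R / N%:R).
  by rewrite /ent -n1E /c mulrAC.
split.
- case=> Ht [h11 h22 h21] hrow hd hQ; split; [|exact/diag|exact/col].
  split=> //.
  + by move=> i j ji i1; apply: h11; lia.
  + move=> i j ji i2; rewrite /ent h22; [|lia|lia].
    by congr (entry _ _ _); lia.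
  + by move=> i j j1 i1; apply: h21; lia.
  move=> j j1; rewrite /ent -n1E hrow; last lia.
  by rewrite /d; congr (_ * _); rewrite big_add1.
case=> -[Ht h11 h22 h21 hrow] /diag hd /col hQ; split=> //.
  split.
  - move=> k j jk kn; have := h11 k.-1 j.-1; rewrite /ent !prednK; try lia.
    by apply; lia.
  - move=> k j jk kn; have := h22 (k.-1 - N')%N (j.-1 - N')%N.
    rewrite /ent !subnK; try lia.
    have -> : k.-1.+1 = k by lia.
    have -> : j.-1.+1 = j by lia.
    have -> : (k.-1 - N').+1 = (k - N')%N by lia.
    have -> : (j.-1 - N').+1 = (j - N')%N by lia.
    by apply; lia.
  move=> k j jn kn; have := h21 k.-1 j.-1; rewrite /ent !prednK; try lia.
  by apply; lia.
move=> [|j] // jn; have := hrow j; rewrite /ent -n1E => ->; last lia.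
by rewrite /d; congr (_ * _); rewrite big_add1.
Qed.
Variables (q1 q2 : nat -> {poly R}).
Hypotheses (iq1 : impulse n1 (ent H1) q1) (iq2 : impulse n2 (ent H2) q2).

Section Blocks.
Variables (H : 'M[R]_n) (P : nat -> {poly R}).
Hypotheses (gH : glued_entries H) (iP : impulse n (ent H) P).

(** The last block of [H] is [H2], so the shifted polynomials solve the impulse recursion of [H2],
    which has only one solution. *)
Lemma right_block l : (l <= n2)%N -> P (l + N') = q2 l.
Proof.
move=> ln; apply: (impulse_unique (p := fun l => P (l + N')%N) _ iq2 ln).
apply/impulse_natP; have /impulse_natP[Pn hP] := iP; split.
  by rewrite -Pn; congr P; lia.
move=> j jn; rewrite hP; last lia.
congr (_ * _); rewrite big_addn (_ : (n - N')%N = n2); last lia.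
apply: eq_big_nat => i /andP[ji i2]; rewrite (glued_22 gH) //; congr (_ *: _).
rewrite -addSn big_addn; apply: congr_big_nat => //; lia.
Qed.

Lemma right_tail l :
  \sum_((l + n1).+1 <= k < n.+1) P k = \sum_(l <= k < n2.+1) q2 k.
Proof.
have -> : (l + n1).+1 = (l + N')%N by lia.
rewrite big_addn (_ : (n.+1 - N')%N = n2.+1); last lia.
by apply: eq_big_nat => k /andP[_ kn]; rewrite right_block.
Qed.

Hypothesis f2 : flat n2 q2.
Hypothesis Pn1 : P n1 = c *: ('X^(n2.+1) - flatpoly R n2).

(** Let [F = flatpoly R n2]. As [c + d = 1], the middle polynomial and the right tail add up to
    [c 'X^(n2+1) + d F], so every tail starting in the left block has an excess [d F]. The row of
    [N'], with factor [- d], multiplies exactly [F] and cancels it. *)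
Lemma left_block j : (j < n1)%N -> P j = (c *: 'X^(n2.+1)) * q1 j.
Proof.
move: {2}(n1 - j)%N (leqnn (n1 - j)) => m; elim: m j => [|m IH] j jm j1; first lia.
have /impulse_natP[Pn hP] := iP; have /impulse_natP[q1n hq1] := iq1.
have T1 : \sum_(n1.+1 <= k < n.+1) P k = flatpoly R n2.
  by rewrite -[n1]add0n right_tail -psum_nat f2.
have T i : (i < n1)%N -> (j <= i)%N -> \sum_(i.+1 <= k < n.+1) P k =
    (c *: 'X^(n2.+1)) * \sum_(i.+1 <= k < n1.+1) q1 k + d *: flatpoly R n2.
  move=> i1 ji; rewrite (@big_cat_nat _ _ _ n1.+1) /=; [|lia|lia].
  rewrite T1 !big_nat_recr //= q1n Pn1 mulrDr mulr1 mulr_sumr -!addrA.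
  congr (_ + _); last first.
    by rewrite -{2}[flatpoly R n2]scale1r -cd scalerDl scalerBr addrA subrK.
  by apply: eq_big_nat => k /andP[ik k1]; apply: IH => //; lia.
rewrite hP; last lia.
rewrite hq1 // mulrCA; congr (_ * _).
rewrite (@big_cat_nat _ _ _ n1.+1) /=; [|lia|lia].
rewrite [X in _ + X]big_nat_cond [X in _ + X]big1 ?addr0 => [|i]; last first.
  by rewrite andbT => ?; rewrite (glued_21 gH) ?scale0r.
rewrite big_nat_recr /=; last lia.
rewrite T1 (glued_row gH) // mulNr scaleNr mulrC mulr_suml scaler_suml -sumrB mulr_sumr.
apply: eq_big_nat => i /andP[ji i1].
rewrite (glued_11 gH) // T // scalerDr scalerA addrK.
by rewrite -scalerAr.
Qed.
End Blocks.

Hypothesis f2 : flat n2 q2.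
Let T2 l := \sum_(l <= k < n2.+1) q2 k.

Let T2S l : (l <= n2)%N -> T2 l = q2 l + T2 l.+1.
Proof. by move=> ln; rewrite /T2 big_ltn. Qed.

Let size_T2 l : (size (T2 l) <= (n2 - l).+1)%N.
Proof.
rewrite /T2 big_nat_cond (leq_trans (size_sum _ _ _)) //.
apply/bigmax_leqP_seq => k _ /andP[/andP[lk kn] _].
by rewrite (leq_trans (size_impulse iq2 _)) // ltnS leq_sub2l.
Qed.

(** Flatness gives [T2 0] full degree. If [T2 l] has degree [n2 - l], its leading term comes from
    [q2 l], and there only from the product of the [l]-th diagonal entry with [T2 l.+1], whose
    leading coefficient is thus nonzero. *)
Let lead_T2 l : (l <= n2)%N -> (T2 l)`_(n2 - l) != 0.
Proof.
elim: l => [_|l IH ln].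
  by rewrite subn0 /T2 -psum_nat f2 coef_poly ltnSn invr_eq0 pnatr_eq0.
have /impulse_natP[_ hq] := iq2.
have := IH (ltnW ln); rewrite T2S ?(ltnW ln) // coefD.
rewrite [X in _ + X]nth_default ?addr0; last first.
  by rewrite (leq_trans (size_T2 _)) // subnS prednK ?subn_gt0.
rewrite hq // mulrBl mul1r coefB coefXM subn_eq0 leqNgt ln /= -(subnS n2 l) !coef_sum.
rewrite [X in _ - X]big_nat_cond [X in _ - X]big1 ?subr0; last first.
  move=> i /andP[/andP[li i2] _]; rewrite coefZ nth_default ?mulr0 //.
  by rewrite (leq_trans (size_T2 _)) //; lia.
rewrite big_ltn // [X in _ + X]big_nat_cond [X in _ + X]big1 ?addr0; last first.
  move=> i /andP[/andP[li i2] _]; rewrite coefZ nth_default ?mulr0 //.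
  by rewrite (leq_trans (size_T2 _)) //; lia.
by rewrite coefZ mulf_eq0 negb_or -!coef_sum => /andP[_].
Qed.

Let B e := T2 (n2 - e).

Let size_B e : (e < n2.+1)%N -> (size (B e) <= e.+1)%N.
Proof. by move=> en; rewrite (leq_trans (size_T2 _)) ?subKn. Qed.

Let lead_B e : (e < n2.+1)%N -> (B e)`_e != 0.
Proof.
by move=> en; have := @lead_T2 (n2 - e) (leq_subr _ _); rewrite subKn.
Qed.

Let X1 : ('X - 1 : {poly R}) != 0.
Proof. by rewrite -polyC1 polyXsubC_eq0. Qed.

(** The column of [N'], read from the bottom up, consists of the coordinates of the middle
    polynomial over ['X - 1] in the triangular basis [B]. *)
Lemma column_impulse H : glued_entries H -> impulse_poly H n1 =
  ('X - 1) * \sum_(e < n2.+1) ent H (n2 - e + n1) n1 *: B e.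
Proof.
move=> gH; have iP := impulse_polyP H; have /impulse_natP[_ hP] := iP.
rewrite hP //; congr (_ * _); rewrite -{1}[n1]add0n big_addn.
rewrite (_ : (n - n1)%N = n2.+1); last lia.
rewrite big_nat_rev /= big_mkord; apply: eq_bigr => e _.
by rewrite add0n subSS (right_tail gH iP).
Qed.

(** In degree [n2 + 1] only the diagonal entry contributes, multiplied by the leading coefficient of
    [B n2], the flat polynomial. *)
Lemma glued_diag H : glued_entries H -> glued_column H ->
  ent H n1 n1 = c * (N - N')%:R.
Proof.
move=> gH; rewrite /glued_column column_impulse // => E.
have := congr1 (fun p : {poly R} => p`_(n2.+1)) E.
rewrite /= mulrBl mul1r coefB coefXM /= coefZ coefB coefXn eqxx coef_poly ltnn subr0 mulr1.
rewrite !coef_sum [X in _ - X]big1 ?subr0 => [|e _]; last first.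
  by rewrite coefZ nth_default ?mulr0 // (leq_trans (size_B _)) ?ltn_ord.
rewrite big_ord_recr /= big1 ?add0r => [|e _]; last first.
  rewrite coefZ nth_default ?mulr0 // (leq_trans (size_B _)) ?ltn_ord //.
  by rewrite ltnS ltnW.
rewrite subnn add0n coefZ /B subnn /T2 -psum_nat f2 coef_poly ltnSn n2E => <-.
by rewrite divfK // pnatr_eq0.
Qed.

Lemma glued_unique H K : glued_entries H -> glued_column H ->
  glued_entries K -> glued_column K -> H = K.
Proof.
move=> gH cH gK cK.
have col e : (e < n2.+1)%N -> ent H (n2 - e + n1) n1 = ent K (n2 - e + n1) n1.
  move=> en; apply/eqP; rewrite -subr_eq0; apply/eqP; move: e en.
  apply: (triangular_free size_B lead_B).
  apply: (mulfI X1); rewrite mulr0.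
  under eq_bigr => e _ do rewrite scalerBl.
  by rewrite sumrB mulrBr -!column_impulse // cH cK subrr.
apply/matrixP => i j; have [ij|ji] := ltnP i j.
  by rewrite !(is_trig_mxP _ _) ?(glued_trig gH) ?(glued_trig gK).
rewrite -!ent_ord; have := ltn_ord i => iN.
have [i1|] := ltnP i n1; first by rewrite !glued_11.
rewrite leq_eqVlt => /orP[/eqP i1|i1].
  have [j1|j1] := ltnP j n1; first by rewrite -i1 !glued_row.
  have -> : nat_of_ord j = n1 by apply/eqP; rewrite eqn_leq j1 {1}i1 ji.
  by have := col (n1 + n2 - i)%N; rewrite (_ : (n2 - _ + n1)%N = i); [apply; lia|lia].
have [j1|] := ltnP j n1; first by rewrite !glued_21 ?i1.
rewrite leq_eqVlt => /orP[/eqP <-|j1].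
  by have := col (n1 + n2 - i)%N; rewrite (_ : (n2 - _ + n1)%N = i); [apply; lia|lia].
have := glued_22 gH (i := i - N') (j := j - N').
have := glued_22 gK (i := i - N') (j := j - N').
by rewrite !subnK; try lia; move=> -> //; [move=> -> // |..]; lia.
Qed.
(** The prescribed middle polynomial vanishes at [1]; its quotient [W] by ['X - 1] has degree at
    most [n2], and the coordinates of [W] in [B] supply the column. *)
Lemma glued_exists : exists H, glued_entries H /\ glued_column H.
Proof.
have [W WE sW] : exists2 W, c *: ('X^(n2.+1) - flatpoly R n2) = ('X - 1) * W &
    (size W <= n2.+1)%N.
  pose p := c *: ('X^(n2.+1) - flatpoly R n2).
  have /factor_theorem [W pW] : root p 1.
    rewrite /root hornerZ hornerD hornerXn hornerN expr1n.
    rewrite (_ : flatpoly R n2 = psum n2 q2) ?horner_sum; last exact/esym/f2.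
    rewrite big_ord_recr /= big1 => [|k _].
      by rewrite (impulse_root1 iq2) // eqxx add0r subrr mulr0.
    by rewrite (impulse_root1 iq2) 1?ltnW ?ltn_ord //= ltn_eqF.
  exists W; first by rewrite -/p pW polyC1 mulrC.
  have [->|W0] := eqVneq W 0; first by rewrite size_poly0.
  have : (size p <= n2.+2)%N.
    apply: leq_trans (size_scale_leq _ _) _.
    apply: leq_trans (size_polyD _ _) _; rewrite size_polyN size_polyXn geq_max leqnn.
    by rewrite (leq_trans (size_poly _ _)).
  by rewrite pW size_Mmonic ?monicXsubC // size_XsubC addn2.
have [x Wx] := triangular_span size_B lead_B sW.
pose K : 'M[R]_n := \matrix_(i, j)
  if (i < j)%N then 0 else if (i < n1)%N then ent H1 i j
  else if (n1 < j)%N then ent H2 (i - N') (j - N')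
  else if j == n1 :> nat then x (n2 - (i - n1))%N
  else if i == n1 :> nat then - d * \sum_(j <= k < n1) ent H1 k j else 0.
have KE i j : (i < n)%N -> (j < n)%N -> ent K i j =
  if (i < j)%N then 0 else if (i < n1)%N then ent H1 i j
  else if (n1 < j)%N then ent H2 (i - N') (j - N')
  else if j == n1 then x (n2 - (i - n1))%N
  else if i == n1 then - d * \sum_(j <= k < n1) ent H1 k j else 0.
  by move=> i_n jn; rewrite -[i]/(nat_of_ord (Ordinal i_n)) -[j]/(nat_of_ord (Ordinal jn)) ent_ord mxE.
have gK : glued_entries K.
  split.
  - by apply/is_trig_mxP => i j ij; rewrite mxE ij.
  - by move=> i j ji i1; rewrite KE; [|lia|lia]; rewrite ltnNge ji i1.
  - move=> i j ji i2; rewrite KE; [|lia|lia].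
    rewrite ltnNge leq_add2r ji /= ltnNge (_ : (n1 <= i + N')%N); last lia.
    by rewrite /= (_ : (n1 < j + N')%N) ?addnK //; lia.
  - move=> i j j1 /andP[i1 i_n]; rewrite KE //; last lia.
    rewrite ltnNge (leq_trans (ltnW j1) (ltnW i1)) /= ltnNge (ltnW i1) /=.
    by rewrite ltnNge (ltnW j1) /= (ltn_eqF j1) (gtn_eqF i1).
  move=> j j1; rewrite KE //; last lia.
  by rewrite ltnNge (ltnW j1) /= ltnn (ltn_eqF j1) eqxx.
exists K; split=> //; rewrite /glued_column column_impulse // WE Wx; congr (_ * _).
apply: eq_bigr => e _; congr (_ *: _); rewrite KE //; last first.
  by have := ltn_ord e; lia.
rewrite ltnNge leq_addl /= ltnn eqxx addnK subKn //.
exact: leq_ord.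
Qed.

(** Existence and uniqueness together ensure that [xget] does not fall back on its default [0]. *)
Lemma glue_mxP : is_glued H1 H2 (glue_mx (N := N) (N' := N') H1 H2).
Proof.
have [K [gK cK]] := glued_exists.
have uK : unique (is_glued H1 H2) K.
  split; first by apply/is_gluedE; split=> //; exact: glued_diag.
  by move=> L /is_gluedE[gL _ cL]; apply: glued_unique.
by have [] := xgetI 0 uK.
Qed.

End Gluing.

(** * Products of shifted and of flat polynomials *)

Section PdotShift.
Variable R : realType.
Implicit Types p q : {poly R}.

Lemma pdotZr n a p q : pdot n p (a *: q) = a * pdot n p q.
Proof. by rewrite pdotC pdotZl pdotC. Qed.

Lemma pdotBl n p q r : pdot n (p - q) r = pdot n p r - pdot n q r.
Proof. by rewrite /pdot -sumrB; apply: eq_bigr => b _; rewrite coefB mulrBl. Qed.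

Lemma pdot_shift m k p q : pdot (m + k) ('X^m * p) ('X^m * q) = pdot k p q.
Proof.
rewrite /pdot -addnS big_split_ord /= big1 ?add0r => [|b _].
  by apply: eq_bigr => b _; rewrite !coefXnM !ltnNge leq_addr /= addKn.
by rewrite !coefXnM ltn_ord mul0r.
Qed.

Lemma pdot_shift0 n m p q : (size q <= m)%N -> pdot n ('X^m * p) q = 0.
Proof.
move=> sq; apply: big1 => b _; rewrite coefXnM; case: ltnP => bm.
  by rewrite mul0r.
by rewrite [q`_b]nth_default ?mulr0 // (leq_trans sq).
Qed.

Lemma pdot_widen m n p q : (m <= n)%N -> (size p <= m.+1)%N -> pdot n p q = pdot m p q.
Proof.
move=> mn sp; rewrite /pdot [RHS](big_ord_widen n.+1 (fun b => p`_b * q`_b)) // [RHS]big_mkcond /=.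
apply: eq_bigr => b _; case: ltnP => // mb.
by rewrite nth_default ?mul0r // (leq_trans sp).
Qed.

Lemma pdot_flatpoly n k q : (k <= n)%N -> (size q <= k.+1)%N ->
  pdot n (flatpoly R k) q = q.[1] / k.+1%:R.
Proof.
move=> kn sq; rewrite (pdot_widen _ kn) ?size_poly // (horner_coef_wide _ sq) mulr_suml.
by apply: eq_bigr => b _; rewrite coef_poly ltn_ord expr1n mulr1 mulrC.
Qed.
End PdotShift.

(** * Optimality and certificates of the glued matrix *)

Section GluedCertificates.
Variables (R : realType) (N N' : nat).
Hypothesis hN' : (1 <= N' <= N.-1)%N.
Local Notation n := (N.-1).
Local Notation n1 := (N'.-1).
Local Notation n2 := ((N - N').-1).
Variables (H1 : 'M[R]_n1) (H2 : 'M[R]_n2) (H : 'M[R]_n).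
Hypotheses (S1 : Hstar H1) (S2 : Hstar H2) (gH : is_glued H1 H2 H).

Let q1 := impulse_poly H1.
Let q2 := impulse_poly H2.
Let P := impulse_poly H.
Let iq1 : impulse n1 (ent H1) q1 := impulse_polyP H1.
Let iq2 : impulse n2 (ent H2) q2 := impulse_polyP H2.
Let iP : impulse n (ent H) P := impulse_polyP H.
Let f1 : flat n1 q1 := flat_of_Hstar S1 iq1.
Let f2 : flat n2 q2 := flat_of_Hstar S2 iq2.

Let c : R := N'%:R / N%:R.
Let d : R := (N - N')%:R / N%:R.
Let N0 : N%:R != 0 :> R. Proof. by rewrite pnatr_eq0; lia. Qed.
Let nE : n = (n2.+1 + n1)%N. Proof. lia. Qed.
Let n2E : (N - N')%N = n2.+1. Proof. lia. Qed.
Let n1E : N' = n1.+1. Proof. lia. Qed.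
Let NE : N = n.+1. Proof. lia. Qed.
Let cd : c + d = 1.
Proof. by rewrite /c /d -mulrDl -natrD subnKC ?divff //; lia. Qed.

Let gE : glued_entries H1 H2 H.
Proof. by case/(is_gluedE hN'): gH. Qed.

Let Pright l : (l <= n2)%N -> P (l + N') = q2 l.
Proof. exact: (right_block hN' iq2 gE iP). Qed.

Let Pmid : P n1 = c *: ('X^(n2.+1) - flatpoly R n2).
Proof. by case/(is_gluedE hN'): gH. Qed.

Let Pleft j : (j < n1)%N -> P j = c *: ('X^(n2.+1) * q1 j).
Proof. by move=> j1; rewrite (left_block hN' iq1 iq2 gE iP f2 Pmid) // -scalerAl. Qed.

Lemma glued_flat : flat n P.
Proof.
rewrite /flat psum_nat (@big_cat_nat _ _ _ n1.+1) /=; [|lia|lia].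
rewrite big_nat_recr //= Pmid.
have -> : \sum_(n1.+1 <= k < n.+1) P k = flatpoly R n2.
  rewrite -[n1]add0n (right_tail hN' iq2 gE iP) -psum_nat; exact: f2.
(* The [- 1] removes [q1 n1 = 1], the last node of [H1], whose place the middle polynomial takes. *)
have -> : \sum_(0 <= k < n1) P k = c *: ('X^(n2.+1) * (flatpoly R n1 - 1)).
  have -> : flatpoly R n1 - 1 = \sum_(0 <= k < n1) q1 k.
    rewrite (_ : flatpoly R n1 = psum n1 q1); last exact/esym/f1.
    by rewrite psum_nat big_nat_recr //= (proj1 iq1) addrK.
  by rewrite mulr_sumr scaler_sumr; apply: eq_big_nat => k /andP[_ k1]; rewrite Pleft.
have -> : c *: ('X^(n2.+1) * (flatpoly R n1 - 1)) + c *: ('X^(n2.+1) - flatpoly R n2) +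
   flatpoly R n2 = c *: ('X^(n2.+1) * flatpoly R n1) + d *: flatpoly R n2.
  rewrite mulrBr mulr1 -scalerDr addrA subrK scalerBr -addrA; congr (_ + _).
  by rewrite -{2}[flatpoly R n2]scale1r -cd scalerDl addKr.
apply/polyP => b; rewrite coefD !coefZ coefXnM !coef_poly -NE -n2E -n1E.
case: ltnP => bN.
  rewrite mulr0 add0r ifT; last lia.
  by rewrite /d mulrAC divff ?mul1r // pnatr_eq0; lia.
rewrite mulr0 addr0; have -> : (b - (N - N') < N')%N = (b < N)%N by lia.
case: ifP => _; last by rewrite mulr0.
by rewrite /c mulrAC divff ?mul1r // pnatr_eq0; lia.
Qed.

(** Left polynomials are multiples of ['X^(n2+1)], right ones have smaller degree. Against the left,
    the middle polynomial acts as its part [c 'X^(n2+1) q1_n1]; against the right, as a flat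
    polynomial, that is, as evaluation at [1], which is nonzero only at the last node. *)
Lemma glued_pdot j k : (j < k <= n)%N -> pdot n (P j) (P k) =
  if (k <= n1)%N then c ^+ 2 * pdot n1 (q1 j) (q1 k)
  else if (n1 < j)%N then pdot n2 (q2 (j - N')) (q2 (k - N'))
  else if (k == n) && (j == n1) then - (c / n2.+1%:R) else 0.
Proof.
move=> /andP[jk kn].
have sq2 l : (l <= n2)%N -> (size (q2 l) <= n2.+1)%N.
  by move=> ln; rewrite (leq_trans (size_impulse iq2 ln)) // ltnS leq_subr.
have sF : (size (flatpoly R n2) <= n2.+1)%N by exact: size_poly.
case: (leqP k n1) => k1.
  have j1 : (j < n1)%N by exact: leq_trans k1.
  rewrite Pleft // pdotZl; move: k1; rewrite leq_eqVlt => /orP[/eqP ->|k1].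
    rewrite Pmid pdotZr pdotC pdotBl pdotC (pdotC _ (flatpoly _ _)) [pdot _ _ (flatpoly _ _)]pdot_shift0 // subr0.
    rewrite -['X^_ in X in pdot _ _ X]mulr1 nE pdot_shift (proj1 iq1) mulrA -expr2.
    by congr (_ * _); congr (pdot _ _ _).
  by rewrite Pleft // pdotZr mulrA -expr2 nE pdot_shift.
have [l ll kE] : exists2 l, (l <= n2)%N & k = (l + N')%N.
  by exists (k - N')%N; lia.
rewrite kE Pright // addnK.
case: (ltnP n1 j) => j1.
  have jE : j = (j - N' + N')%N by lia.
  have jl : (j - N' <= n2)%N by lia.
  by rewrite {1}jE Pright // (pdot_widen _ _ (sq2 _ jl)) //; lia.
move: j1; rewrite leq_eqVlt => /orP[/eqP ->|j1]; last first.
  by rewrite Pleft // pdotZl pdot_shift0 ?sq2 // mulr0 (ltn_eqF j1) andbF.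
rewrite eqxx andbT Pmid pdotZl pdotBl -['X^_]mulr1 pdot_shift0 ?sq2 // sub0r.
rewrite pdot_flatpoly ?sq2 //; last lia.
rewrite (impulse_root1 iq2) // (_ : (l + N' == n) = (l == n2)); last lia.
by case: eqP => _; rewrite ?mul0r ?oppr0 ?mulr0 // mul1r mulrN.
Qed.

Lemma glued_Hstar : Hstar H.
Proof.
apply: (Hstar_of_impulse (glued_trig gE) iP glued_flat).
suff lt j k : (j < k <= n)%N -> pdot n (P j) (P k) <= 0.
  move=> j k jn kn; have [jk _|kj _|-> /eqP //] := ltngtP j k.
    by apply: lt; rewrite jk.
  by rewrite pdotC; apply: lt; rewrite kj.
move=> jk; rewrite glued_pdot //; move/andP: jk => [jk kn].
have c0 : 0 <= c by rewrite divr_ge0.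
case: ifP => k1.
  rewrite mulr_ge0_le0 ?sqr_ge0 // (pdot_Hstar S1 iq1) //; last by rewrite ltn_eqF.
  by rewrite (leq_trans _ k1) // ltnW.
case: ifP => j1; first by rewrite (pdot_Hstar S2 iq2) //; lia.
by case: ifP => _ //; rewrite oppr_le0 divr_ge0.
Qed.

(** Certificates are Gram entries times minus the number of nodes: the factor [c^2] turns into
    [c^2 N / N' = N' / N], the factor [1] into [N / (N - N')], and the entry [- c / (N - N')] into
    [N' / (N - N')]. *)
Lemma glued_certE k j : (1 <= j)%N -> (j < k <= N)%N ->
  lambda_star H k j = glue_cert N N' (lambda_star H1) (lambda_star H2) k j.
Proof.
case: k j => [|k] [|j] // _ jk; rewrite /glue_cert.
have jkn : (j < k <= n)%N by lia.
rewrite lambda_starE // glued_pdot // -NE.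
have N'0 : N'%:R != 0 :> R by rewrite pnatr_eq0; lia.
have NN'0 : (N - N')%:R != 0 :> R by rewrite pnatr_eq0; lia.
have -> : (k <= n1)%N = (k.+1 <= N')%N by lia.
case: ifP => kN'.
  rewrite lambda_starE; last lia.
  by rewrite -n1E /c; field.
have -> : (n1 < j)%N = (N' < j.+1)%N by lia.
case: ifP => jN'.
  have -> : (k.+1 - N')%N = (k - N').+1 by lia.
  have -> : (j.+1 - N')%N = (j - N').+1 by lia.
  rewrite lambda_starE; last lia.
  by rewrite -n2E; field.
have -> : (k == n) = (k.+1 == N) by lia.
have -> : (j == n1) = (j.+1 == N') by lia.
case: ifP => _; last by rewrite mulr0.
by rewrite -n2E /c; field; rewrite NN'0 N0.
Qed.

End GluedCertificates.

(** * Vertices *)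

Section Vertices.
Variables (R : realType).

Lemma vertex_index_unique n (H : 'M[R]_n) j k :
  (j < k <= n.+1)%N -> 0 < lambda_star H k j ->
  (forall i, (j < i <= n.+1)%N -> 0 < lambda_star H i j -> i = k) ->
  vertex_index H j = k.
Proof. by move=> jk l0 u; apply: xget_unique => // i [ji li]; exact: u. Qed.

Lemma vertex_indexP n (H : 'M[R]_n) j : is_vertex H -> (1 <= j <= n)%N ->
  [/\ (j < vertex_index H j <= n.+1)%N, 0 < lambda_star H (vertex_index H j) j &
   forall i, (j < i <= n.+1)%N -> 0 < lambda_star H i j -> i = vertex_index H j].
Proof.
move=> [_ vH] jn; have [k [[jk lk] uk]] := vH j jn.
have -> : vertex_index H j = k.
  by apply: vertex_index_unique => // i ji li; apply/esym/uk.
by split=> // i ji li; apply/esym/uk.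
Qed.

Variables (N N' : nat).
Hypothesis hN' : (1 <= N' <= N.-1)%N.
Variables (H1 : 'M[R]_(N'.-1)) (H2 : 'M[R]_((N - N').-1)) (H : 'M[R]_(N.-1)).
Hypotheses (v1 : is_vertex H1) (v2 : is_vertex H2).
Hypothesis gc : forall k j : nat, (1 <= j)%N -> (j < k <= N)%N ->
  lambda_star H k j = glue_cert N N' (lambda_star H1) (lambda_star H2) k j.

Let glued_index j : nat :=
  if (j < N')%N then vertex_index H1 j
  else if j == N' then N else (vertex_index H2 (j - N') + N')%N.

Let glued_indexP j : (1 <= j <= N.-1)%N ->
  [/\ (j < glued_index j <= N)%N, 0 < lambda_star H (glued_index j) j &
   forall i, (j < i <= N)%N -> 0 < lambda_star H i j -> i = glued_index j].
Proof.
have c0 : 0 < N'%:R / N%:R :> R by rewrite divr_gt0 // ltr0n; lia.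
have d0 : 0 < N%:R / (N - N')%:R :> R by rewrite divr_gt0 // ltr0n; lia.
have e0 : 0 < N'%:R / (N - N')%:R :> R by rewrite divr_gt0 // ltr0n; lia.
move=> jn; rewrite /glued_index; case: (ltngtP j N') => jN'.
- have [|jk lk u] := vertex_indexP v1 (j := j); first by lia.
  have kN' : (vertex_index H1 j <= N')%N by lia.
  split; first by lia.
    by rewrite gc /glue_cert; [rewrite kN' mulr_gt0|lia|lia].
  move=> i ji; rewrite gc /glue_cert; [|lia|lia].
  case: ifP => iN'; first by rewrite pmulr_rgt0 // => li; apply: u => //; lia.
  (* For [j < N'] all certificates at [i > N'] are zero, so the index coming from [H1] stays
     unique. *)
  by rewrite ltnNge (ltnW jN') /= (ltn_eqF jN') andbF ltxx.
- have [|jk lk u] := vertex_indexP v2 (j := (j - N')%N); first by lia.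
  have kN' : (vertex_index H2 (j - N') + N' <= N')%N = false by lia.
  split; first by lia.
    by rewrite gc /glue_cert; [rewrite kN' jN' addnK mulr_gt0|lia|lia].
  move=> i ji; rewrite gc /glue_cert; [|lia|lia].
  have -> : (i <= N')%N = false by lia.
  rewrite jN' pmulr_rgt0 // => li.
  by rewrite -(u (i - N')%N) //; lia.
rewrite jN'; split; first by lia.
  rewrite gc /glue_cert; [|lia|lia].
  have -> : (N <= N')%N = false by lia.
  by rewrite ltnn !eqxx.
move=> i ji; rewrite gc /glue_cert; [|lia|lia].
have -> : (i <= N')%N = false by lia.
by rewrite ltnn eqxx andbT; case: eqP => //; rewrite ltxx.
Qed.

Let NE : N.-1.+1 = N. Proof. lia. Qed.

Let vertex_index_glued j : (1 <= j <= N.-1)%N -> vertex_index H j = glued_index j.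
Proof.
move=> jn; have [jk lk u] := glued_indexP jn.
by apply: vertex_index_unique => [|//|i]; rewrite NE //; exact: u.
Qed.

Lemma glued_is_vertex : Hstar H -> is_vertex H.
Proof.
move=> SH; split=> // j jn; have [jk lk u] := glued_indexP jn.
exists (glued_index j); rewrite NE; split; first by split.
by move=> i [ji li]; apply/esym/u.
Qed.

Lemma glued_arc_diagram :
  arc_diagram H = glue_arcs N N' (arc_diagram H1) (arc_diagram H2).
Proof.
apply/seteqP; split=> [[a b]|[a b]].
  move=> [j /= jn [<- <-]]; rewrite vertex_index_glued // /glued_index.
  case: (ltngtP j N') => jN'.
  - by left; left; exists j => //=; lia.
  - left; right; exists (vertex_index H2 (j - N'), (j - N')%N) => /=.
      by exists (j - N')%N => //=; lia.
    by rewrite subnK // ltnW.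
  by right; rewrite /= jN'.
case=> [[[j /= jn [<- <-]]|[_ [j /= jn <-] [<- <-]]]|/= [-> ->]].
- exists j => /=; first by lia.
  rewrite vertex_index_glued /glued_index; last lia.
  by rewrite ifT //; lia.
- exists (j + N')%N => /=; first by lia.
  rewrite vertex_index_glued /glued_index; last lia.
  by rewrite ifF ?ifF ?addnK //; lia.
exists N' => /=; first by lia.
by rewrite vertex_index_glued // /glued_index ltnn eqxx.
Qed.

End Vertices.

Theorem theorem2 (R : realType) (N N' : nat) (hN' : (1 <= N' <= N.-1)%N)
    (H1 : 'M[R]_(N'.-1)) (H2 : 'M[R]_((N - N').-1))
    (hH1 : Hstar H1) (hH2 : Hstar H2) :
  Hstar (glue_mx H1 H2) /\
  (forall k j : nat, (1 <= j)%N -> (j < k <= N)%N ->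
     lambda_star (glue_mx H1 H2) k j =
       glue_cert N N' (lambda_star H1) (lambda_star H2) k j) /\
  (is_vertex H1 -> is_vertex H2 ->
     is_vertex (glue_mx H1 H2) /\
     arc_diagram (glue_mx H1 H2) =
       glue_arcs N N' (arc_diagram H1) (arc_diagram H2)).
Proof.
have i2 := impulse_polyP H2.
have gH : is_glued H1 H2 (glue_mx (N := N) H1 H2).
  exact: (glue_mxP hN' H1 i2 (flat_of_Hstar hH2 i2)).
have SH := glued_Hstar hN' hH1 hH2 gH.
have gc := glued_certE hN' hH2 gH.
split=> //; split=> // v1 v2; split; first exact: glued_is_vertex gc SH.
exact: glued_arc_diagram.
Qed.
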